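(* Let $G$ be an infinite group generated by $\Sigma$, let $A=\bigoplus_{i\in\Omega}\langle t_i\rangle$ have rank at least $2$, and let $S$ be a rewriting system over $W(A,\Gamma)$ as described in the context. Let $x\in\mathrm{E}(A,G)$ (represented by a word $x\in R^*(A,G)$) be a torsion element which is not conjugate in $\mathrm{E}(A,G)$ to any element of $G$ (where $G$ is viewed as a subgroup of $\mathrm{E}(A,G)$ via the canonical embedding). Then there is a reduction $x\Rightarrow_S^* y$ with $y\in W(A,\Gamma)$ such that $y=\overline y$. In particular, $x^2=1$ in $\mathrm{E}(A,G)$.
   Context: Ordered group $A$. $\Omega$ is a set of ordinals with least element $0$; $A=\bigoplus_{i\in\Omega}\langle t_i\rangle$ with each $\langle t_i\rangle\cong\mathbb{Z}$. For $\alpha=\sum_i n_it_i\neq 0$, $\deg(\alpha)$ is the greatest $i$ with $n_i\ne 0$; $\alpha$ is positive if $n_{\deg(\alpha)}>0$; $\alpha\le\beta$ iff $\alpha=\beta$ or $\beta-\alpha$ is positive. $\mathbb{Z}$ is a subgroup of $A$ via $n\mapsto nt_0$, so $1=t_0$ is the least positive element. Words. $a\ne1$ in $G$ for all $a\in\Sigma$; $\Gamma=\Sigma\cup\Sigma^{-1}\subseteq G$, $\overline a=a^{-1}$ for $a\in\Gamma$, and $\pi:\Gamma^*\to G$ is the induced monoid homomorphism. A (closed) $A$-word of length $\alpha\ge 0$ is a map $p:[1,\alpha]\to\Gamma$, where $[1,\alpha]=\{\beta\in A: 1\le\beta\le\alpha\}$; $|p|=\alpha$. $W(A,\Gamma)$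 is the monoid of $A$-words under concatenation: $(p\cdot q)(\beta)=p(\beta)$ for $1\le\beta\le|p|$ and $(p\cdot q)(\beta)=q(\beta-|p|)$ for $|p|<\beta\le|p|+|q|$. The involution is $\overline p(\beta)=\overline{p(|p|+1-\beta)}$. A word is finite if $|p|\in\mathbb{N}$ and infinite otherwise; finite words are identified with elements of $\Gamma^*$. A word $x$ is $G$-reduced if no non-empty finite factor of $x$ (a finite $f\ne1$ with $x=pfq$) equals $1$ in $G$ under $\pi$. $R(A,G)$ is the set of $G$-reduced words and $R^*(A,G)$ the submonoid of $W(A,\Gamma)$ generated by $R(A,G)$. The group $\mathrm{E}(A,G)$. $\mathcal{M}(A,G)$ is the quotient monoid of $W(A,\Gamma)$ by the relations $u\,\ell\,\overline{r}\,\overline{u}=1$ for all $u\in R(A,G)$ and $\ell,r\in\Gamma^*$ with $\pi(\ell)=\pi(r)$. $\mathrm{E}(A,G)$ is the image of $R^*(A,G)$ in $\mathcal{M}(A,G)$; it is a group. The system $S$. $S_0\subseteq\Gamma^*\times\Gamma^*$ is a fixed (possibly infinite, non-terminating) rewriting system such that: (1) $\Gamma^*/S_0=G$; (2) $(a\overline a,1)\in S_0$ for all $a\in\Gamma$; (3) $(\ell,r)\in S_0$ implies $(\overline\ell,\overline r)\in S_0$; (4) $1\in\Gamma^*$ is $S_0$-irreducible; (5) $S_0$ is confluent. Then $S=S_0\cup\{u\overline u\to1: u\in R(A,G),\ u\text{ infinite}\}$. For words $x,y\in W(A,\Gamma)$, $x\Rightarrow_S y$ means $x=p\ell q$, $y=prq$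 for some rule $(\ell,r)\in S$ and $p,q\in W(A,\Gamma)$; $\Rightarrow_S^*$ is the reflexive transitive closure. One has $\mathcal{M}(A,G)=W(A,\Gamma)/S$. *)

(* Defs.v *)
From HB Require Import structures.
From Stdlib Require Import Relation_Operators.
From mathcomp Require Import all_boot all_order all_algebra generic_quotient.
From mathcomp Require Import finmap.
From mathcomp.multinomials Require Import monalg.
From mathcomp Require Import boolp classical_sets cardinality.

Set Implicit Arguments.
Unset Strict Implicit.
Unset Printing Implicit Defensive.

Import Order.TTheory GRing.Theory Num.Theory.

Local Open Scope quotient_scope.
Local Open Scope ring_scope.

Section OrderedGroup.
Context {d : Order.disp_t} (Om : bOrderType d).

(* [{malg int[Om]}] is the free abelian group on [Om], i.e. the finitely
   supported integer families; [\bot%O] is the least element 0 of [Om]. *)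
Definition ogroup : Type := {malg int[Om]}.

HB.instance Definition _ := Choice.on ogroup.
HB.instance Definition _ := GRing.Zmodule.on ogroup.

Definition tgen (i : Om) : ogroup := << i >>.

(* The identification of a natural number n with n t_0 is [t0 *+ n]. *)
Definition t0 : ogroup := tgen \bot%O.

(* [deg 0] is the junk value [\bot]. *)
Definition deg (a : ogroup) : Om :=
  \big[Order.max / \bot%O]_(i <- msupp (a : {malg int[Om]})) i.

(* For a = 0 all coefficients vanish, so 0 is not positive. *)
Definition positive (a : ogroup) : bool := 0 < mcoeff (deg a) a.

Definition ogroup_le (a b : ogroup) : bool := (a == b) || positive (b - a).

Lemma deg_max (a : ogroup) i : mcoeff i a != 0 -> (i <= deg a)%O.
Proof.
rewrite mcoeff_neq0 => ia; rewrite /deg.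
have : i \in (msupp (a : {malg int[Om]}) : seq Om) by [].
elim: (finmap.enum_fset _) => //= j s IHs; rewrite inE big_cons => /orP[/eqP->|/IHs].
  by rewrite le_max lexx.
by rewrite le_max orbC => ->.
Qed.

Lemma deg_neq0 (a : ogroup) : a != 0 -> mcoeff (deg a) a != 0.
Proof.
move=> a0; rewrite mcoeff_neq0.
have ex i s : i \in s -> \big[Order.max / \bot%O]_(k <- s) k \in (s : seq Om).
  elim: s i => //= j s IHs i _; rewrite big_cons.
  case: s IHs => [|k s] IHs.
    by rewrite big_nil maxEle lex0; case: eqP => [->|]; rewrite ?inE ?eqxx.
  rewrite maxEle; case: ifP => _; last by rewrite inE eqxx.
  by rewrite inE (IHs k) ?orbT // inE eqxx.
have [i] : exists i, i \in msupp (a : {malg int[Om]}).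
  apply/not_existsP => h; move/eqP: a0; apply; apply/malgP => k.
  by rewrite mcoeff0; apply/eqP; rewrite mcoeff_eq0; apply/negP/h.
by move/ex.
Qed.

Lemma deg_eq (a : ogroup) i : mcoeff i a != 0 ->
  (forall j, (i < j)%O -> mcoeff j a = 0) -> deg a = i.
Proof.
move=> ai hi; have := deg_max ai; rewrite le_eqVlt => /orP[/eqP->//|/hi h].
have /deg_neq0 : a != 0 by apply: contraNneq ai => ->; rewrite mcoeff0.
by rewrite h eqxx.
Qed.

Lemma deg_above (a : ogroup) j : (deg a < j)%O -> mcoeff j a = 0.
Proof. by move=> h; apply/eqP/negPn/negP => /deg_max; rewrite leNgt h. Qed.

Lemma positiveP (a : ogroup) : reflect
  (exists2 i, 0 < mcoeff i a & forall j, (i < j)%O -> mcoeff j a = 0)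
  (positive a).
Proof.
apply: (iffP idP) => [pa|[i ai hi]].
  by exists (deg a) => // j /deg_above.
by rewrite /positive (deg_eq _ hi) // gt_eqF.
Qed.

Lemma positive0 : positive 0 = false.
Proof. by rewrite /positive mcoeff0. Qed.

Lemma positiveN (a : ogroup) : a != 0 -> positive (- a) = ~~ positive a.
Proof.
move=> a0; rewrite /positive.
have -> : deg (- a) = deg a.
  apply: deg_eq; first by rewrite mcoeffN oppr_eq0 deg_neq0.
  by move=> j /deg_above h; rewrite mcoeffN h oppr0.
by rewrite mcoeffN oppr_gt0 -leNgt le_eqVlt (negbTE (deg_neq0 a0)).
Qed.

Lemma positiveD (a b : ogroup) : positive a -> positive b -> positive (a + b).
Proof.
move=> /positiveP[i ai hi] /positiveP[j bj hj]; apply/positiveP.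
case: (ltgtP i j) => [ij|ji|ij].
- exists j => [|k jk]; first by rewrite mcoeffD hi // add0r.
  by rewrite mcoeffD hj // hi ?addr0 // (lt_trans ij).
- exists i => [|k ik]; first by rewrite mcoeffD hj // addr0.
  by rewrite mcoeffD hi // hj ?addr0 // (lt_trans ji).
- subst j; exists i => [|k ik]; first by rewrite mcoeffD addr_gt0.
  by rewrite mcoeffD hi // hj ?addr0.
Qed.

Fact ogroup_le_anti : antisymmetric ogroup_le.
Proof.
move=> a b /andP[]; rewrite /ogroup_le.
case: eqVneq => //= ab pba; rewrite -opprB positiveN ?subr_eq0 1?eq_sym //.
by rewrite pba.
Qed.

Fact ogroup_le_trans : transitive ogroup_le.
Proof.
move=> b a c; rewrite /ogroup_le => /orP[/eqP->//|pba] /orP[/eqP<-|pcb].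
  by rewrite pba orbT.
by rewrite -(subrKA b) (positiveD pcb) ?orbT // opprK.
Qed.

Fact ogroup_le_total : total ogroup_le.
Proof.
move=> a b; rewrite /ogroup_le; case: eqVneq => //= ab.
rewrite -[a - b]opprB positiveN ?subr_eq0 1?eq_sym //.
by case: positive; rewrite ?orbT.
Qed.

Fact ogroup_le_refl : reflexive ogroup_le.
Proof. by move=> a; rewrite /ogroup_le eqxx. Qed.

HB.instance Definition _ := Order.Le_isPOrder.Build ring_display ogroup
  ogroup_le_refl ogroup_le_anti ogroup_le_trans.
HB.instance Definition _ :=
  Order.POrder_isTotal.Build ring_display ogroup ogroup_le_total.

Implicit Types a b c : ogroup.

Lemma ogroup_leE a b : (a <= b) = (a == b) || positive (b - a).
Proof. by []. Qed.

Lemma ogroup_ltE a b : (a < b) = positive (b - a).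
Proof.
rewrite lt_def ogroup_leE eq_sym; case: eqVneq => //= <-.
by rewrite subrr positive0.
Qed.

Lemma ogroup_leD2r c a b : (a + c <= b + c) = (a <= b).
Proof. by rewrite !ogroup_leE (inj_eq (addIr c)) opprD addrACA subrr addr0. Qed.

Lemma t0_gt0 : 0 < t0.
Proof.
rewrite ogroup_ltE subr0; apply/positiveP; exists \bot%O => [|j j0].
  by rewrite mcoeffU eqxx.
by rewrite mcoeffU lt_eqF.
Qed.

Lemma t0_le a : (t0 <= a) = (0 < a).
Proof.
apply/idP/idP => [|]; first exact: (lt_le_trans t0_gt0).
rewrite ogroup_ltE subr0 ogroup_leE => /positiveP[i ai hi].
case: (eqVneq t0 a) => //= t0a.
case: (eqVneq i \bot%O) => [i0|i0]; last first.
  apply/positiveP; exists i => [|j ij].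
    by rewrite mcoeffB mcoeffU eq_sym (negbTE i0) subr0.
  rewrite mcoeffB hi // mcoeffU lt_eqF ?subrr //.
  exact: le_lt_trans (le0x _) ij.
apply/positiveP; exists \bot%O => [|j j0]; last first.
  by rewrite mcoeffB mcoeffU lt_eqF // hi ?subrr // i0.
rewrite mcoeffB mcoeffU eqxx subr_gt0 lt_neqAle; rewrite i0 in ai hi.
have -> : 1 <= mcoeff \bot%O a by [].
rewrite andbT; apply: contra_neq t0a => h; apply/malgP => k.
case: (eqVneq k \bot%O) => [->|k0]; first by rewrite mcoeffU eqxx.
by rewrite hi ?lt0x // mcoeffU eq_sym (negbTE k0).
Qed.

Lemma ogroup_leBl (a b c : ogroup) : (b - a <= c) = (b <= a + c).
Proof. by rewrite -[LHS](ogroup_leD2r a) subrK addrC. Qed.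

Lemma ogroup_leBr (a b c : ogroup) : (c <= b - a) = (a + c <= b).
Proof. by rewrite -[LHS](ogroup_leD2r a) subrK addrC. Qed.

Lemma ogroup_leD2l (c a b : ogroup) : (c + a <= c + b) = (a <= b).
Proof. by rewrite ![c + _]addrC ogroup_leD2r. Qed.

Lemma ogroup_succ_le (a b : ogroup) : (a + t0 <= b) = (a < b).
Proof. by rewrite -ogroup_leBr t0_le !ogroup_ltE subr0. Qed.

Lemma ogroup_le_addr (a b c : ogroup) : 0 <= c -> a <= b -> a <= b + c.
Proof. by move=> c0 ab; apply: (le_trans ab); rewrite -{1}[b]addr0 ogroup_leD2l. Qed.

End OrderedGroup.

Arguments t0 {d Om}.

Section Words.
Context {d : Order.disp_t} (Om : bOrderType d) {G : groupType} (Sg : set G).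

Local Notation A := (ogroup Om).

Definition alphabet : set G := Sg `|` [set a^-1%g | a in Sg].

Definition letter : Type := set_type alphabet.

Fact linv_subproof (a : letter) : (val a)^-1%g \in alphabet.
Proof.
apply/mem_set; case: a => a /= /set_mem[Sa|[b Sb <-]].
  by right; exists a.
by left; rewrite invgK.
Qed.

Definition linv (a : letter) : letter := Sub ((val a)^-1)%g (linv_subproof a).

Lemma linvK : involutive linv.
Proof. by move=> a; apply: val_inj; rewrite /= invgK. Qed.

Definition fbar (s : seq letter) : seq letter := rev (map linv s).

Definition feval (s : seq letter) : G := (\prod_(a <- s) val a)%g.

(* A map [1, wlen] -> letter is encoded as a partial function on the whole
   ordered group whose domain is exactly [1, wlen]; two words are then equal
   iff they have the same length and the same values (see [wordP]). *)
Record word := Word {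
  wlen : A;
  wfun :> A -> option letter;
  wlen_ge0 : 0 <= wlen;
  wdom : forall b, isSome (wfun b) = (t0 <= b <= wlen) }.

HB.instance Definition _ := gen_eqMixin word.
HB.instance Definition _ := gen_choiceMixin word.

Lemma wordP (p q : word) : wlen p = wlen q -> p =1 q -> p = q.
Proof.
case: p q => [lp p p0 pd] [lq q q0 qd] /= ll /funext pq; subst lq q.
by congr Word; apply: Prop_irrelevance.
Qed.

Lemma wordN (p : word) b : ~~ (t0 <= b <= wlen p) -> p b = None.
Proof. by rewrite -wdom; case: (p b). Qed.

Fact wone_dom b : isSome (None : option letter) = (t0 <= b <= (0 : A)).
Proof.
by apply/esym/negP => /andP[+ b0]; rewrite t0_le ltNge b0.
Qed.

Definition wone : word := Word (lexx 0) wone_dom.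

Definition wmul_fun (p q : word) (b : A) : option letter :=
  if b <= wlen p then p b else q (b - wlen p).

Fact wmul_ge0 (p q : word) : 0 <= wlen p + wlen q.
Proof. exact: ogroup_le_addr (wlen_ge0 q) (wlen_ge0 p). Qed.

Fact wmul_dom (p q : word) b :
  isSome (wmul_fun p q b) = (t0 <= b <= wlen p + wlen q).
Proof.
rewrite /wmul_fun; case: leP => [bp|pb].
  by rewrite wdom bp (ogroup_le_addr (wlen_ge0 q) bp).
rewrite wdom ogroup_leBl ogroup_leBr ogroup_succ_le pb /=.
by rewrite t0_le (le_lt_trans (wlen_ge0 p) pb).
Qed.

Definition wmul (p q : word) : word := Word (wmul_ge0 p q) (wmul_dom p q).

Fact wmulA : associative wmul.
Proof.
move=> p q r; apply: wordP => [|b]; rewrite /= /wmul_fun /= ?addrA //.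
rewrite /wmul_fun ogroup_leBl opprD addrA; case: (leP b (wlen p)) => // bp.
by rewrite (ogroup_le_addr (wlen_ge0 q) bp).
Qed.

Fact wmul1w : left_id wone wmul.
Proof.
move=> p; apply: wordP => [|b]; rewrite /= /wmul_fun /= ?add0r // subr0.
case: leP => // b0; rewrite wordN // negb_and t0_le ltNge b0 //.
Qed.

Fact wmulw1 : right_id wone wmul.
Proof.
move=> p; apply: wordP => [|b]; rewrite /= /wmul_fun /= ?addr0 //.
by case: leP => // bp; rewrite wordN // negb_and orbC leNgt bp.
Qed.

HB.instance Definition _ := isMonoid.Build word wmulA wmul1w wmulw1.

Definition wbar_fun (p : word) (b : A) : option letter :=
  omap linv (p (wlen p + t0 - b)).

Fact wbar_dom (p : word) b : isSome (wbar_fun p b) = (t0 <= b <= wlen p).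
Proof.
rewrite /wbar_fun; have -> o : isSome (omap linv o) = isSome o by case: o.
by rewrite wdom ogroup_leBr ogroup_leBl ogroup_leD2r [b + _]addrC ogroup_leD2l andbC.
Qed.

Definition wbar (p : word) : word := Word (wlen_ge0 p) (wbar_dom p).

Lemma wbarK : involutive wbar.
Proof.
move=> p; apply: wordP => [//|b]; rewrite /= /wbar_fun /= /wbar_fun.
rewrite opprB addrC subrK; case: (p b) => //= a.
by rewrite linvK.
Qed.

Lemma wbarM (p q : word) : wbar (p * q)%g = (wbar q * wbar p)%g.
Proof.
apply: wordP => [|b]; rewrite /= ?[_ + wlen p]addrC //.
rewrite /wbar_fun /= /wmul_fun /= /wbar_fun.
have -> : (wlen p + wlen q + t0 - b <= wlen p) = (wlen q < b).
  by rewrite ogroup_leBl [b + _]addrC -addrA ogroup_leD2l ogroup_succ_le.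
rewrite ltNge; case: (b <= wlen q) => /=.
  suff -> : wlen p + wlen q + t0 - b - wlen p = wlen q + t0 - b by [].
  by rewrite -!addrA [LHS]addrC -!addrA addNr addr0.
suff -> : wlen p + wlen q + t0 - b = wlen p + t0 - (b - wlen q) by [].
by rewrite opprB !addrA; congr (_ - _); rewrite addrAC.
Qed.

Lemma wbar1 : wbar 1%g = 1%g.
Proof. exact: wordP. Qed.

Fact wletter_dom (a : letter) b :
  isSome (if b == t0 then Some a else None) = (t0 <= b <= (t0 : A)).
Proof. by rewrite -eq_le eq_sym; case: eqVneq. Qed.

Definition wletter (a : letter) : word :=
  Word (ltW (t0_gt0 Om)) (wletter_dom a).

(* The identification of finite words with the elements of the free monoid *)
Definition finw (s : seq letter) : word := (\prod_(a <- s) wletter a)%g.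

Definition infinite (u : word) : Prop := forall n : nat, wlen u <> t0 *+ n.

Definition reduced (x : word) : Prop :=
  forall (p : word) (f : seq letter) (q : word),
    x = (p * finw f * q)%g -> f <> [::] -> feval f <> 1%g.

Inductive rstar : word -> Prop :=
| rstar1 : rstar 1%g
| rstar_reduced u : reduced u -> rstar u
| rstarM u v : rstar u -> rstar v -> rstar (u * v)%g.

Lemma finw_cat s t : finw (s ++ t) = (finw s * finw t)%g.
Proof. exact: big_cat. Qed.

Lemma finw_cons a s : finw (a :: s) = (wletter a * finw s)%g.
Proof. exact: big_cons. Qed.

Lemma finw_nil : finw [::] = 1%g.
Proof. exact: big_nil. Qed.

Lemma finw_seq1 a : finw [:: a] = wletter a.
Proof. exact: big_seq1. Qed.

Lemma feval_cat s t : feval (s ++ t) = (feval s * feval t)%g.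
Proof. exact: big_cat. Qed.

Lemma feval_cons a s : feval (a :: s) = (val a * feval s)%g.
Proof. exact: big_cons. Qed.

Lemma feval_nil : feval [::] = 1%g.
Proof. exact: big_nil. Qed.

Lemma fbarK : involutive fbar.
Proof. by move=> s; rewrite /fbar map_rev revK (mapK linvK). Qed.

Lemma fbar_cat s t : fbar (s ++ t) = fbar t ++ fbar s.
Proof. by rewrite /fbar map_cat rev_cat. Qed.

Lemma feval_bar s : feval (fbar s) = (feval s)^-1%g.
Proof.
elim: s => [|a s IHs]; first by rewrite feval_nil invg1.
rewrite -cat1s fbar_cat !feval_cat IHs invgM; congr (_ * _)%g.
by rewrite !feval_cons feval_nil !mulg1.
Qed.

Lemma wbar_letter a : wbar (wletter a) = wletter (linv a).
Proof.
apply: wordP => [//|b]; rewrite /= /wbar_fun /=.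
rewrite -(inj_eq (addIr b)) subrK (inj_eq (addrI t0)) eq_sym.
by case: eqP.
Qed.

Lemma wbar_finw s : wbar (finw s) = finw (fbar s).
Proof.
elim: s => [|a s IHs]; first by rewrite finw_nil wbar1.
rewrite finw_cons wbarM IHs -cat1s fbar_cat finw_cat wbar_letter.
by rewrite finw_seq1.
Qed.

Lemma wlen_finw s : wlen (finw s) = t0 *+ size s.
Proof.
elim: s => [|a s IHs]; first by rewrite finw_nil.
by rewrite finw_cons /= mulrS IHs.
Qed.

Lemma reduced_bar x : reduced x -> reduced (wbar x).
Proof.
move=> rx p f q xE f0 f1.
apply: (rx (wbar q) (fbar f) (wbar p)).
- by rewrite -[x]wbarK xE !wbarM wbar_finw mulgA.
- by move=> h; apply: f0; rewrite -[f]fbarK h.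
- by rewrite feval_bar f1 invg1.
Qed.

Lemma wlen_sub (p q : word) : wlen p <= wlen (p * q)%g.
Proof. exact: ogroup_le_addr (wlen_ge0 q) (lexx _). Qed.

Lemma wlen_sub3 (p f q : word) : wlen f <= wlen (p * f * q)%g.
Proof.
apply: le_trans (wlen_sub _ _); rewrite /= addrC.
exact: ogroup_le_addr (wlen_ge0 p) (lexx _).
Qed.

Lemma wlen_eq0 (p : word) : wlen p = 0 -> p = 1%g.
Proof.
move=> p0; apply: wordP => [//|b]; rewrite wordN // p0 negb_and t0_le.
by case: ltP.
Qed.

Lemma mulr_t0_gt n : 0 < (t0 : A) *+ n.+1.
Proof.
elim: n => [|n IHn]; first exact: t0_gt0.
by rewrite mulrS (lt_le_trans IHn) // addrC ogroup_le_addr // ltW ?t0_gt0.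
Qed.

Lemma reduced1 : reduced 1%g.
Proof.
move=> p [//|a f] q h _; have := wlen_sub3 p (finw (a :: f)) q.
by rewrite -h wlen_finw /= leNgt mulr_t0_gt.
Qed.

Lemma reduced_letter (a : letter) : val a <> 1%g -> reduced (wletter a).
Proof.
move=> a1 p f q h f0; have := congr1 wlen h; rewrite /= wlen_finw.
case: f f0 h => [//|b f] _ h /= hl.
have pq0 : wlen p + (t0 *+ size f + wlen q) = 0.
  apply: (addIr t0); rewrite add0r [RHS]hl mulrS addrA.
  by rewrite [LHS]addrAC -[_ + _ + t0]addrA [t0 *+ _ + t0]addrC.
have s0 : t0 *+ size f + wlen q = 0 :> A.
  have sq0 : 0 <= t0 *+ size f + wlen q :> A.
    apply: ogroup_le_addr; rewrite ?wlen_ge0 //.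
    by case: (size f) => // n; rewrite ltW ?mulr_t0_gt.
  apply/le_anti/andP; split=> //; rewrite -[leRHS]pq0 [leRHS]addrC.
  exact: ogroup_le_addr (wlen_ge0 p) (lexx _).
move: pq0; rewrite s0 addr0 => p0.
have f0 : f = [::].
  case: f s0 {h hl} => [//|c f] s0; have := mulr_t0_gt (size f).
  by rewrite ltNge -s0 /= ogroup_le_addr ?wlen_ge0.
move: s0; rewrite f0 add0r => q0; move: h; rewrite f0.
rewrite (wlen_eq0 p0) (wlen_eq0 q0) mulg1 mul1g finw_seq1 => /(congr1 wfun).
move=> /(congr1 (@^~ t0)) /=; rewrite eqxx => -[<-].
by rewrite feval_cons feval_nil mulg1.
Qed.

Lemma rstar_finw s : (forall a, Sg a -> a <> 1%g) -> rstar (finw s).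
Proof.
move=> S1; elim: s => [|a s IHs]; first by rewrite finw_nil; exact: rstar1.
rewrite finw_cons; apply: rstarM => //; apply: rstar_reduced.
apply: reduced_letter; case: a => a /= /set_mem[/S1//|[b /S1 b1 <-]] h.
by apply: b1; rewrite -[b]invgK h invg1.
Qed.

(* [rstep mul S] is the one step relation of the rewriting system [S] on the
   monoid with product [mul]. *)
Definition rstep (T : Type) (mul : T -> T -> T) (S : T -> T -> Prop)
    (x y : T) : Prop :=
  exists p q l r, [/\ S l r, x = mul (mul p l) q & y = mul (mul p r) q].

Definition irreducible (T : Type) (R : T -> T -> Prop) (x : T) : Prop :=
  forall y, ~ R x y.

Definition confluent (T : Type) (R : T -> T -> Prop) : Prop :=
  forall x y z, clos_refl_trans T R x y -> clos_refl_trans T R x z ->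
    exists2 t, clos_refl_trans T R y t & clos_refl_trans T R z t.

(* M(A, G) is [mquot] below, the quotient of the words by the congruence
   generated by [mrel]. *)
Definition mrel (x y : word) : Prop :=
  exists (u : word) (l r : seq letter),
    [/\ reduced u, feval l = feval r,
        x = (u * finw l * wbar (finw r) * wbar u)%g & y = 1%g].

Definition mcong : word -> word -> Prop :=
  clos_refl_sym_trans word (rstep *%g mrel).

Lemma rstepM (T : monoidType) (S : T -> T -> Prop) (a b x y : T) :
  clos_refl_sym_trans T (rstep *%g S) x y ->
  clos_refl_sym_trans T (rstep *%g S) (a * x * b)%g (a * y * b)%g.
Proof.
elim=> [{}x {}y [p [q [l [r [Slr -> ->]]]]]|{}x|{}x {}y _|{}x {}y z _ h1 _ h2].
- by apply: rst_step; exists (a * p)%g, (q * b)%g, l, r; rewrite !mulgA.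
- exact: rst_refl.
- exact: rst_sym.
- exact: rst_trans h1 h2.
Qed.

Definition mcongb (x y : word) : bool := `[< mcong x y >].

Fact mcongb_refl : reflexive mcongb.
Proof. by move=> x; apply/asboolP; exact: rst_refl. Qed.

Fact mcongb_sym : symmetric mcongb.
Proof.
by move=> x y; apply/asboolP/asboolP; exact: rst_sym.
Qed.

Fact mcongb_trans : transitive mcongb.
Proof.
by move=> y x z /asboolP xy /asboolP yz; apply/asboolP; exact: rst_trans xy yz.
Qed.

Definition mcong_equiv : equiv_rel word :=
  EquivRel mcongb mcongb_refl mcongb_sym mcongb_trans.

Definition mquot : Type := {eq_quot mcong_equiv}.

HB.instance Definition _ := Choice.on mquot.

Definition mclass (x : word) : mquot := \pi_({eq_quot mcong_equiv}) x.

Definition mrepr (m : mquot) : word := repr (m : {eq_quot mcong_equiv}).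

Lemma mreprK : cancel mrepr mclass.
Proof. exact: reprK. Qed.

Lemma mclassP x y : mclass x = mclass y <-> mcong x y.
Proof.
by split=> [/eqmodP/asboolP|h] //; apply/eqmodP/asboolP.
Qed.

Definition qone : mquot := mclass 1%g.

Definition qmul (a b : mquot) : mquot := mclass (mrepr a * mrepr b)%g.

Lemma qmulE x y : qmul (mclass x) (mclass y) = mclass (x * y)%g.
Proof.
have h z : mcong (mrepr (mclass z)) z by apply/mclassP; exact: mreprK.
apply/mclassP; apply: (@rst_trans _ _ _ (x * mrepr (mclass y))%g).
  by have := rstepM 1%g (mrepr (mclass y)) (h x); rewrite !mul1g.
by have := rstepM x 1%g (h y); rewrite !mulg1.
Qed.

Fact qmulA : associative qmul.
Proof.
move=> a b c; rewrite -[a]mreprK -[b]mreprK -[c]mreprK.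
by rewrite !qmulE mulgA.
Qed.

Fact qmul1m : left_id qone qmul.
Proof. by move=> a; rewrite -[a]mreprK qmulE mul1g. Qed.

Fact qmulm1 : right_id qone qmul.
Proof. by move=> a; rewrite -[a]mreprK qmulE mulg1. Qed.

HB.instance Definition _ := isMonoid.Build mquot qmulA qmul1m qmulm1.

Lemma mclassM x y : mclass (x * y)%g = (mclass x * mclass y)%g.
Proof. exact: esym (qmulE x y). Qed.

Lemma mclass1 : mclass 1%g = 1%g.
Proof. by []. Qed.

Lemma mclass_rel u l r : reduced u -> feval l = feval r ->
  mclass (u * finw l * wbar (finw r) * wbar u)%g = 1%g.
Proof.
move=> ru lr; apply/mclassP; apply: rst_step.
exists 1%g, 1%g, (u * finw l * wbar (finw r) * wbar u)%g, 1%g.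
by rewrite !mulg1 !mul1g; split=> //; exists u, l, r.
Qed.

Lemma mclass_reduced u : reduced u -> mclass (u * wbar u)%g = 1%g.
Proof.
move=> ru; have := mclass_rel ru (erefl (feval [::])).
by rewrite finw_nil wbar1 !mulg1.
Qed.

Lemma mclass_rstar u : rstar u ->
  rstar (wbar u) /\ mclass (u * wbar u)%g = 1%g.
Proof.
elim=> [|{}u ru|{}u v _ [hu1 hu2] _ [hv1 hv2]].
- by rewrite wbar1 mulg1; split=> //; exact: rstar1.
- split; last exact: mclass_reduced.
  by apply: rstar_reduced; exact: reduced_bar.
- rewrite wbarM; split; first exact: rstarM.
  by rewrite -mulgA mclassM [(v * _)%g]mulgA mclassM hv2 mul1g -mclassM.
Qed.

Definition egroup_set : set mquot := [set m | exists2 x, rstar x & m = mclass x].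

Definition egroup : Type := set_type egroup_set.

HB.instance Definition _ := SubChoice.on egroup.

Fact ein_subproof x : rstar x -> mclass x \in egroup_set.
Proof. by move=> rx; apply/mem_set; exists x. Qed.

Definition ein (x : word) (rx : rstar x) : egroup :=
  exist _ (mclass x) (ein_subproof rx).

Fact erepr_subproof (e : egroup) : exists x, rstar x /\ mclass x = val e.
Proof. by case: e => e /= /set_mem[x rx ->]; exists x. Qed.

Definition erepr (e : egroup) : word := projT1 (cid (erepr_subproof e)).

Lemma ereprP e : rstar (erepr e).
Proof. by rewrite /erepr; case: cid => x []. Qed.

Lemma ereprK e : mclass (erepr e) = val e.
Proof. by rewrite /erepr; case: cid => x []. Qed.

Definition eone : egroup := ein rstar1.

Definition emul (e f : egroup) : egroup := ein (rstarM (ereprP e) (ereprP f)).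

Definition einv (e : egroup) : egroup := ein (mclass_rstar (ereprP e)).1.

Lemma val_emul e f : val (emul e f) = (val e * val f)%g.
Proof. by rewrite -(ereprK e) -(ereprK f) -mclassM. Qed.

Fact emulA : associative emul.
Proof. by move=> e f g; apply: val_inj; rewrite !val_emul mulgA. Qed.

Fact emul1e : left_id eone emul.
Proof. by move=> e; apply: val_inj; rewrite val_emul; exact: mul1g. Qed.

Fact emule1 : right_id eone emul.
Proof. by move=> e; apply: val_inj; rewrite val_emul; exact: mulg1. Qed.

Fact emulVe : left_inverse eone einv emul.
Proof.
move=> e; apply: val_inj; rewrite val_emul -[X in (_ * X)%g]ereprK -mclassM.
rewrite -[X in (_ * X)%g]wbarK.
exact: (mclass_rstar (mclass_rstar (ereprP e)).1).2.
Qed.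

Fact emuleV : right_inverse eone einv emul.
Proof.
move=> e; apply: val_inj; rewrite val_emul -[X in (X * _)%g]ereprK -mclassM.
exact: (mclass_rstar (ereprP e)).2.
Qed.

HB.instance Definition _ :=
  isGroup.Build egroup emulA emul1e emule1 emulVe emuleV.

Lemma val_egroupM (e f : egroup) : val (e * f)%g = (val e * val f)%g.
Proof. exact: val_emul. Qed.

Lemma val_egroup1 : val (1%g : egroup) = 1%g.
Proof. by []. Qed.

Definition generates : Prop :=
  forall H : set G, H 1%g -> (forall a b, H a -> H b -> H (a * b)%g) ->
    (forall a, H a -> H a^-1%g) -> (Sg `<=` H)%classic -> forall g, H g.

(* The other half of the isomorphism of the quotient with G, the surjectivity
   of [feval], is [generates] (see [fword_subproof]). *)
Record admissible (S0 : seq letter -> seq letter -> Prop) : Prop := Admissible {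
  admissible_quotient : forall s t,
    clos_refl_sym_trans (seq letter) (rstep cat S0) s t <-> feval s = feval t;
  admissible_inv : forall a, S0 [:: a; linv a] [::];
  admissible_bar : forall l r, S0 l r -> S0 (fbar l) (fbar r);
  admissible_nil : irreducible (rstep cat S0) [::];
  admissible_confluent : confluent (rstep cat S0) }.

Definition srule (S0 : seq letter -> seq letter -> Prop) (x y : word) : Prop :=
  (exists l r, [/\ S0 l r, x = finw l & y = finw r]) \/
  (exists u, [/\ reduced u, infinite u, x = (u * wbar u)%g & y = 1%g]).

Definition sstar (S0 : seq letter -> seq letter -> Prop) : word -> word -> Prop :=
  clos_refl_trans word (rstep *%g (srule S0)).

Context (Sg1 : forall a, Sg a -> a <> 1%g) (Sgen : generates).

Fact fword_subproof (g : G) : exists s, feval s = g.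
Proof.
pose H : set G := [set x | exists s, feval s = x]%classic.
suff : H g by [].
apply: Sgen; rewrite /H /=.
- by exists [::]; rewrite feval_nil.
- by move=> a b [s <-] [t <-]; exists (s ++ t); rewrite feval_cat.
- by move=> a [s <-]; exists (fbar s); rewrite feval_bar.
- move=> a Sa; have aA : a \in alphabet by apply/mem_set; left.
  by exists [:: Sub a aA]; rewrite feval_cons feval_nil mulg1.
Qed.

(* The canonical embedding of G: an element is sent to the class of any finite
   word representing it. *)
Definition emb (g : G) : egroup :=
  ein (rstar_finw (projT1 (cid (fword_subproof g))) Sg1).

Lemma emb_feval s : val (emb (feval s)) = mclass (finw s).
Proof.
rewrite /emb /=; case: cid => t /= ts.
have h a b : feval a = feval b -> mclass (finw a * wbar (finw b))%g = 1%g.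
  by move=> /(mclass_rel reduced1); rewrite mul1g wbar1 mulg1.
rewrite -[LHS]mulg1 -(h (fbar s) (fbar s) erefl) wbar_finw fbarK.
by rewrite mclassM mulgA -wbar_finw -(mclassM (finw t)) (h _ _ ts) mul1g.
Qed.

Lemma embM g h : emb (g * h)%g = (emb g * emb h)%g.
Proof.
have [s <-] := fword_subproof g; have [t <-] := fword_subproof h.
apply: val_inj; rewrite val_egroupM -feval_cat !emb_feval.
by rewrite finw_cat mclassM.
Qed.

End Words.

Definition torsion (T : groupType) (x : T) : Prop :=
  exists2 n : nat, (0 < n)%N & (x ^+ n = 1)%g.

(* Main.v *)
Require Import Defs.
From mathcomp Require Import all_boot all_order all_algebra.
From mathcomp Require Import boolp classical_sets cardinality.
From mathcomp Require Import zify.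
From Stdlib Require Import Relation_Operators.

(** Cancellation in the monoid is planar. A word whose class is that of an
    element of [G] arises from finite words by products and by placing two
    mirror-image reduced arms [u] and [wbar u] around a core that is trivial;
    this is [evaluates]. That nothing else represents an element of [G]
    ([evaluates_mcong]) needs that deleting a pair [u * wbar u] preserves the
    property: [evaluates_delete], through the cut elimination [evaluates_cut].
    Both rest on the fact that no cancellation happens inside a reduced arm.

    Planarity has the usual consequence for polygons: if a product of at least
    three words has a value in [G], then some inner factor is [absorbed], one
    half of it cancelling against the factor on its left and the other half
    against the factor on its right ([evaluates_ear]).

    Let [w] represent a torsion element that is not conjugate into [G], and
    write it as a product of [m] [tight] words, that is, of words reduced
    modulo finite ones. Some power of [w] is trivial, so a side is absorbed in
    the polygon whose sides are these factors, repeated. If [m >= 2], this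
    reduces [w] to [z * w' * wbar z] where [w'] has fewer factors
    ([shortens_middle], [shortens_first]), and a self-inverse reduct of [w']
    gives one of [w]. If [m = 1], then [w] itself is absorbed between two
    copies of [w], which makes [w ^+ 2] conjugate to some torsion [c] in [G]
    ([absorbed_square]). A conjugate of [w] commutes with [c] and is an
    element of [G] times a tight word [r], so that [r] conjugates [c] into [G].
    This is impossible for an infinite [r] unless [c = 1]: some reduced block of
    [r] ends periodically, with a period conjugate to [c] or its inverse, while
    the powers of a period of a reduced word are all nontrivial
    ([tight_centralizer]). So [w * w] is trivial. The cancellation of [w]
    against itself is a [ladder] of matching blocks, and everything depends on
    where the middle of [w] falls: inside a block, what surrounds the middle is
    its own mirror image, and the rest reduces to two mirror images; at a finite distance from the end of a block, [w] is conjugate to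
    an element of [G] ([ladder_centre]).

    Finite words are controlled only through their value in [G] all along. The
    confluence of [S0] enters through [fstar_join]: finite words of equal value
    have a common reduct, which is empty if that value is 1. *)

(** * Words over the ordered group *)

Section WordCalculus.
Set Implicit Arguments.
Unset Strict Implicit.
Import Order.TTheory GRing.Theory.
Local Open Scope ring_scope.
Local Open Scope group_scope.
Context {d : Order.disp_t} {Om : bOrderType d} {G : groupType} {Sg : set G}.
Local Notation A := (ogroup Om).
Local Notation word := (word Om Sg).
Local Notation finw := (@finw _ Om _ Sg).
Implicit Types (x y z p q u v : word) (s t f : seq (letter Sg)) (b c : A).

Lemma ogroup_le_nat (a : A) n : 0 <= a -> a <= t0 *+ n -> exists k, a = t0 *+ k.
Proof.
elim: n a => [|n IHn] a a0 an.
  by exists 0%N; apply/le_anti/andP; split; rewrite // mulr0n.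
case: (eqVneq a 0) => [->|an0]; first by exists 0%N.
have ta : t0 <= a by rewrite t0_le lt_def an0.
have [||k kE] := IHn (a - t0); first by rewrite ogroup_leBr addr0.
  by rewrite ogroup_leBl -mulrS.
by exists k.+1; rewrite mulrS -kE addrC subrK.
Qed.

Lemma eq_wlen x y : x = y -> wlen x = wlen y. Proof. by move->. Qed.

Lemma wlen_bar x : wlen (wbar x) = wlen x. Proof. by []. Qed.

Lemma wlenM x y : wlen (x * y) = wlen x + wlen y. Proof. by []. Qed.

Lemma word_cut x b : 0 <= b <= wlen x ->
  exists p q, x = p * q /\ wlen p = b.
Proof.
move=> /andP[b0 bx].
have pd c : isSome (if c <= b then x c else None) = (t0 <= c <= b).
  case: ifP => cb; last by rewrite andbF.
  by rewrite wdom andbT (le_trans cb bx) andbT.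
have q0 : 0 <= wlen x - b by rewrite ogroup_leBr addr0.
have qd c : isSome (if t0 <= c then x (c + b) else None) = (t0 <= c <= wlen x - b).
  case: ifP => // tc; rewrite wdom ogroup_leBr [b + c]addrC; congr (_ && _).
  apply: le_trans tc _; rewrite -{1}[c]addr0 ogroup_leD2l //.
exists (Word b0 pd), (Word q0 qd); split=> //; apply: wordP => [|c] /=.
  by rewrite addrC subrK.
rewrite /wmul_fun /=; case: leP => // bc.
by rewrite ogroup_leBr ogroup_succ_le bc subrK.
Qed.

Lemma wmulE x y c :
  (x * y) c = if c <= wlen x then x c else y (c - wlen x).
Proof. by []. Qed.

Lemma eq_wmul x y x' y' : x * y = x' * y' -> wlen x = wlen x' ->
  x = x' /\ y = y'.
Proof.
move=> e l; have l2 : wlen y = wlen y'.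
  by have := eq_wlen e; rewrite !wlenM l => /addrI.
have ef c : (x * y) c = (x' * y') c by rewrite e.
split; apply: wordP => // c.
  have := ef c; rewrite !wmulE l; case: leP => // cx _.
  by rewrite !wordN // -?l negb_and -!ltNge ?l cx orbT.
have := ef (c + wlen x); rewrite !wmulE -l.
case: leP => [|_]; last by rewrite addrK.
rewrite -[X in _ <= X]add0r ogroup_leD2r => c0 _.
by rewrite !wordN // negb_and t0_le ltNge c0.
Qed.

Lemma wmulIr x x' y : x * y = x' * y -> x = x'.
Proof.
by move=> e; have := eq_wlen e; rewrite !wlenM => /addIr/(eq_wmul e)[].
Qed.

Lemma wmul_eq1 x y : x * y = 1 -> x = 1 /\ y = 1.
Proof.
move=> e; have l := eq_wlen e; rewrite wlenM /= in l.
have x0 : wlen x = 0.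
  apply/le_anti/andP; split; last exact: wlen_ge0.
  rewrite -[X in _ <= X]l -[X in X <= _]addr0 ogroup_leD2l; exact: wlen_ge0.
split; apply: wlen_eq0 => //.
by rewrite x0 add0r in l.
Qed.

Lemma levi_le x y p q : x * y = p * q -> wlen x <= wlen p ->
  exists z, p = x * z /\ y = z * q.
Proof.
move=> e xp; have [|x' [z [pE x'E]]] := @word_cut p (wlen x).
  by rewrite wlen_ge0 xp.
have [] := @eq_wmul x y x' (z * q); rewrite ?x'E //.
  by rewrite mulgA -pE.
by move=> xE yE; exists z; rewrite pE -xE.
Qed.

(** Equidivisibility replaces the induction on the length, which is not well
    founded here. *)
Lemma levi x y p q : x * y = p * q ->
  (exists z, p = x * z /\ y = z * q) \/ (exists z, x = p * z /\ q = z * y).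
Proof.
move=> e; case: (leP (wlen x) (wlen p)) => [/(levi_le e)|/ltW].
  by left.
by move/(levi_le (esym e)); right.
Qed.

Definition finite_word x : Prop := exists s, x = finw s.

Lemma wlen_letter x : wlen x = t0 -> exists a, x = @wletter d Om G Sg a.
Proof.
move=> xt; have : isSome (x t0) by rewrite wdom xt lexx.
case E : (x t0) => [a|//] _; exists a; apply: wordP => //= c.
case: eqVneq => [->//|c0]; rewrite wordN // xt.
by apply: contra c0; rewrite -eq_le eq_sym.
Qed.

Lemma wlen_finite x n : wlen x = t0 *+ n -> finite_word x.
Proof.
elim: n x => [|n IHn] x xn.
  by exists [::]; rewrite finw_nil; exact: wlen_eq0.
have [|p [q [xE pt]]] := @word_cut x t0.
  rewrite (ltW (t0_gt0 Om)) xn mulrS -{1}[t0]addr0 ogroup_leD2l.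
  by case: (n) => [|k]; rewrite ?lexx // ltW // mulr_t0_gt.
have qn : t0 + wlen q = t0 *+ n.+1 by rewrite -xn xE wlenM pt.
have [a pE] := wlen_letter pt; rewrite xE pE.
have [s ->] : finite_word q.
  by apply: IHn; apply: (@addrI _ t0); rewrite -mulrS -qn.
by exists (a :: s); rewrite finw_cons.
Qed.

Lemma finite_wordP x : finite_word x <-> exists n, wlen x = t0 *+ n.
Proof.
split=> [[s ->]|[n]]; first by exists (size s); rewrite wlen_finw.
exact: wlen_finite.
Qed.

Lemma infinite_wordP x : infinite x <-> ~ finite_word x.
Proof.
split=> [xi /finite_wordP[n /xi]//|xf n xn].
by apply: xf; apply: wlen_finite xn.
Qed.

Lemma finite_finw s : finite_word (finw s). Proof. by exists s. Qed.

Lemma finite1 : finite_word 1. Proof. by exists [::]; rewrite finw_nil. Qed.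

Lemma finite_wbar x : finite_word (wbar x) <-> finite_word x.
Proof.
split=> /finite_wordP[n xn]; apply/finite_wordP; exists n => //.
Qed.

Lemma finite_wmul x y : finite_word (x * y) <-> finite_word x /\ finite_word y.
Proof.
split=> [/finite_wordP[n]|[[s ->] [t ->]]]; last first.
  by exists (s ++ t); rewrite finw_cat.
rewrite wlenM => e; have x0 := wlen_ge0 x; have y0 := wlen_ge0 y.
split; apply/finite_wordP; apply: (@ogroup_le_nat _ n) => //; rewrite -e.
  by rewrite -{1}[wlen x]addr0 ogroup_leD2l.
by rewrite -{1}[wlen y]add0r ogroup_leD2r.
Qed.

Lemma finite_wmulI x y : finite_word x -> finite_word y -> finite_word (x * y).
Proof. by move=> fx fy; exact: (proj2 (finite_wmul x y)). Qed.

Lemma t0_nat_inj m n : (t0 : A) *+ m = t0 *+ n -> m = n.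
Proof.
wlog mn : m n / (m <= n)%N.
  by move=> h e; case/orP: (leq_total m n) => [/h->|/h->].
rewrite -(subnK mn) mulrnDr => /(congr1 (fun z : A => z - t0 *+ m)).
rewrite subrr addrK; case: (n - m)%N => // k /esym e.
by have := mulr_t0_gt Om k; rewrite e ltxx.
Qed.

Lemma finw_inj : injective finw.
Proof.
elim=> [|a s IHs] [|b t] // e.
- have := eq_wlen e; rewrite !wlen_finw => /t0_nat_inj; done.
- have := eq_wlen e; rewrite !wlen_finw => /t0_nat_inj; done.
- move: e; rewrite !finw_cons => /eq_wmul[//|ab /IHs->]; congr (_ :: _).
  have := congr1 (fun z : word => z t0) ab; rewrite /= eqxx; by case.
Qed.

Lemma finw_eq_wmul s x y : finw s = x * y ->
  exists t1 t2, [/\ s = t1 ++ t2, x = finw t1 & y = finw t2].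
Proof.
move=> e; have /finite_wmul[[t xE] [u yE]] : finite_word (x * y) by exists s.
by exists t, u; split=> //; apply: finw_inj; rewrite finw_cat e xE yE.
Qed.

Lemma word_last x : x = 1 \/ exists y a, x = y * @wletter d Om G Sg a.
Proof.
case: (eqVneq (wlen x) 0) => [/wlen_eq0->|x0]; [by left|right].
have tx : t0 <= wlen x by rewrite t0_le lt_def x0 wlen_ge0.
have [|p [q [xE pl]]] := @word_cut x (wlen x - t0).
  by rewrite ogroup_leBr addr0 tx ogroup_leBl addrC -{1}[wlen x]addr0 ogroup_leD2l
       ltW ?t0_gt0.
have [|a qE] := @wlen_letter q; last by exists p, a; rewrite -qE.
have := wlenM p q; rewrite -xE pl => /(congr1 (fun b => b - (wlen x - t0))).
by rewrite addrAC subrr add0r opprB addrC subrK => <-.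
Qed.

End WordCalculus.

(** * Evaluation in G *)

Section Evaluation.
Set Implicit Arguments.
Unset Strict Implicit.
Local Open Scope group_scope.
Context {d : Order.disp_t} {Om : bOrderType d} {G : groupType} {Sg : set G}.
Local Notation word := (word Om Sg).
Local Notation finw := (@finw _ Om _ Sg).
Local Notation letterw := (@wletter _ Om _ Sg).
Implicit Types (x y z p q u v : word) (s t f k : seq (letter Sg)) (g h : G).

Lemma reduced_factor p x q : reduced (p * x * q) -> reduced x.
Proof.
move=> r p' f q' xE; apply: (r (p * p') f (q' * q)).
by rewrite xE !mulgA.
Qed.

Lemma reducedL x y : reduced (x * y) -> reduced x.
Proof. by move=> r; apply: (@reduced_factor 1 x y); rewrite mul1g. Qed.

Lemma reducedR x y : reduced (x * y) -> reduced y.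
Proof. by move=> r; apply: (@reduced_factor x y 1); rewrite mulg1. Qed.

Lemma reduced_finw s : reduced (finw s) -> feval s = 1 -> s = [::].
Proof.
move=> r s1; case: s r s1 => // a s r s1.
by case: (r 1 (a :: s) 1); rewrite ?mulg1 ?mul1g.
Qed.

Lemma reduced_letterV p a q : ~ reduced (p * letterw a * letterw (linv a) * q).
Proof.
move=> r; apply: (r p [:: a; linv a] q).
- by rewrite !finw_cons finw_nil mulg1 !mulgA.
- by [].
- by rewrite !feval_cons feval_nil mulg1 mulgV.
Qed.

Lemma wletter_inj : injective letterw.
Proof.
by move=> a b; rewrite -!finw_seq1 => /finw_inj[].
Qed.

(** The planar cancellations that turn a word into an element of [G]. *)
Inductive evaluates : word -> G -> Prop :=
| evaluates_fin s : evaluates (finw s) (feval s)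
| evaluates_mul x y g h :
    evaluates x g -> evaluates y h -> evaluates (x * y) (g * h)
| evaluates_nest u x :
    reduced u -> evaluates x 1 -> evaluates (u * x * wbar u) 1.

Lemma evaluates1 : evaluates 1 1.
Proof. by have := evaluates_fin [::]; rewrite finw_nil feval_nil. Qed.

Lemma evaluates_letter a : evaluates (letterw a) (val a).
Proof.
by have := evaluates_fin [:: a]; rewrite finw_seq1 feval_cons feval_nil mulg1.
Qed.

Lemma evaluates_eqw x y g h : evaluates x g -> x = y -> g = h -> evaluates y h.
Proof. by move=> + <- <-. Qed.

Lemma evaluates_bar x g : evaluates x g -> evaluates (wbar x) g^-1.
Proof.
elim=> [s|{}x y {}g h _ IHx _ IHy|u {}x ru _ IHx].
- by rewrite wbar_finw -feval_bar; exact: evaluates_fin.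
- by rewrite wbarM invgM; exact: evaluates_mul.
- rewrite !wbarM wbarK invg1 mulgA; apply: evaluates_nest => //.
  by rewrite -[1]invg1.
Qed.

(** A reduced word is trivial in [G] only if it is empty, so a nest around it
    would contain a cancelling pair of letters. *)
Lemma evaluates_reduced x g : evaluates x g -> reduced x ->
  exists2 s, x = finw s & feval s = g.
Proof.
elim=> [s|{}x y {}g h _ IHx _ IHy|u {}x ru _ IHx] r.
- by exists s.
- have [s -> <-] := IHx (reducedL r); have [t -> <-] := IHy (reducedR r).
  by exists (s ++ t); rewrite ?finw_cat ?feval_cat.
- have [s xE s1] := IHx (reduced_factor r).
  have s0 : s = [::] by apply: reduced_finw s1; rewrite -xE; exact: reduced_factor r.
  have -> : x = 1 by rewrite xE s0 finw_nil.
  rewrite mulg1; case: (word_last u) => [->|[v [a uE]]].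
    by exists [::]; rewrite ?feval_nil ?finw_nil ?wbar1 ?mulg1.
  exfalso; apply: (@reduced_letterV v a (wbar v)); move: r.
  by rewrite xE s0 finw_nil mulg1 uE wbarM wbar_letter !mulgA.
Qed.

Lemma evaluates_reduced1 x : evaluates x 1 -> reduced x -> x = 1.
Proof.
move=> e r; have [s xE s1] := evaluates_reduced e r.
by rewrite xE (reduced_finw _ s1) ?finw_nil // -xE.
Qed.

Lemma evaluates_finw s g : evaluates (finw s) g -> feval s = g.
Proof.
move wE: (finw s) => w e; elim: e s wE => {w g}
  [t|x y g h _ IHx _ IHy|u x ru _ IHx] s.
- by move/finw_inj->.
- by move=> /finw_eq_wmul[s1 [s2 [-> /esym/IHx<- /esym/IHy<-]]]; rewrite feval_cat.
- move=> /finw_eq_wmul[s1 [s2 [-> ]]].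
  move/esym/finw_eq_wmul => [s3 [s4 [-> uE /esym/IHx s41]]].
  rewrite uE wbar_finw => /finw_inj <-.
  by rewrite !feval_cat s41 mulg1 feval_bar mulgV.
Qed.

Lemma evaluates_stripl a x g :
  evaluates (letterw a * x) g -> evaluates x ((val a)^-1 * g).
Proof.
move wE: (letterw a * x) => w e; elim: e x wE => {w g}
  [s|z y g h ez IHz ey IHy|u z ru ez IHz] x.
- move=> /esym/finw_eq_wmul[s1 [s2 [-> ]]].
  rewrite -finw_seq1 => /finw_inj <- ->.
  by rewrite feval_cons mulKg; exact: evaluates_fin.
- move=> /levi[[w [zE xE]]|[w [aE yE]]].
    by rewrite xE mulgA; apply: evaluates_mul ey; apply: IHz.
  move: aE; rewrite -finw_seq1 => /finw_eq_wmul[[|b s1] [s2 [sE zE wE]]].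
    rewrite zE in ez.
    have -> : g = 1 by rewrite -(evaluates_finw ez) feval_nil.
    by rewrite mul1g; apply: IHy; rewrite yE wE -[s2]/([::] ++ s2) -sE finw_seq1.
  case: sE => ab /esym/nilP; rewrite /nilp size_cat addn_eq0 => /andP[/nilP s10 /nilP s20].
  rewrite zE s10 -ab in ez; rewrite wE s20 finw_nil mul1g in yE; rewrite -yE.
  by rewrite -(evaluates_finw ez) feval_cons feval_nil mulg1 mulKg.
- case: (word_last (wbar u)) => [/(congr1 (@wbar _ _ _ _))|[v [b]]].
    rewrite wbarK wbar1 => ->; rewrite wbar1 mulg1 mul1g; exact: IHz.
  move/(congr1 (@wbar _ _ _ _)); rewrite wbarK wbarM wbar_letter.
  set b' := linv b => uE; rewrite uE -!mulgA => /eq_wmul[//|aE ->].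
  have e1 : evaluates (wbar v * z * wbar (wbar v)) 1.
    by apply: evaluates_nest => //; move: ru; rewrite uE; exact: reducedR.
  apply: (evaluates_eqw (evaluates_mul e1 (evaluates_letter (linv b')))).
    by rewrite wbarM wbar_letter !mulgA.
  by rewrite mul1g mulg1 (wletter_inj aE).
Qed.

Lemma evaluates_divl s x g :
  evaluates (finw s * x) g -> evaluates x ((feval s)^-1 * g).
Proof.
elim: s x g => [|a s IHs] x g.
  by rewrite finw_nil feval_nil invg1 !mul1g.
rewrite finw_cons -mulgA => /evaluates_stripl/IHs.
by rewrite feval_cons invgM mulgA.
Qed.

Lemma evaluates_divr s x g :
  evaluates (x * finw s) g -> evaluates x (g * (feval s)^-1).
Proof.
move/evaluates_bar; rewrite wbarM wbar_finw => /evaluates_divl/evaluates_bar.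
by rewrite wbarK feval_bar invgK invgM !invgK.
Qed.

Lemma wmul_letter_inj x y a b :
  x * letterw a = y * letterw b -> x = y /\ a = b.
Proof.
move=> e; have l := eq_wlen e; rewrite !wlenM in l.
by have [xy /wletter_inj] := eq_wmul e (GRing.addIr t0 l).
Qed.

Lemma levi_letter x a y p q : x * letterw a * y = p * q ->
  (exists z, p = x * letterw a * z /\ y = z * q) \/
  (exists z, x = p * z /\ q = z * letterw a * y).
Proof.
move/levi=> [[z [pE yE]]|[z [xaE qE]]]; first by left; exists z.
case: (word_last z) => [z1|[z' [b zE]]].
  by left; exists 1; rewrite mulg1 xaE z1 mulg1 qE z1 !mul1g.
have [xE aE] : x = p * z' /\ a = b.
  by apply: wmul_letter_inj; rewrite xaE zE mulgA.
by right; exists z'; rewrite qE zE aE.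
Qed.

(** A letter is indivisible, so it survives whole in one constituent of an
    evaluation; in a nest its mirror image keeps its own letter. *)
Lemma evaluates_subst_letter x a y z g :
  evaluates (x * letterw a * y) g -> evaluates z (val a) ->
  evaluates (x * z * y) g.
Proof.
move oE: (x * letterw a * y) => o e ez; elim: e x y oE => {o g}
  [s|w w' g h ew IHw ew' IHw'|u w ru ew IHw] x y.
- move=> /esym/finw_eq_wmul[s1 [s2 [-> /esym/finw_eq_wmul[s3 [s4 [-> -> ]]]]]].
  rewrite -finw_seq1 => /finw_inj <- ->.
  rewrite !feval_cat feval_cons feval_nil mulg1.
  by do !apply: evaluates_mul => //; exact: evaluates_fin.
- move=> /levi_letter[[v [wE ->]]|[v [-> w'E]]].
    apply: (evaluates_eqw (evaluates_mul (IHw _ _ (esym wE)) ew')) => //.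
    by rewrite !mulgA.
  apply: (evaluates_eqw (evaluates_mul ew (IHw' _ _ (esym w'E)))) => //.
  by rewrite !mulgA.
- have mirror v v' : evaluates v' 1 -> evaluates (z * v' * letterw (linv a)) 1.
    move=> ev; have := evaluates_mul (evaluates_mul ez ev) (evaluates_letter (linv a)).
    by rewrite mulg1 mulgV.
  move=> /levi_letter[[v [/esym/levi_letter[[v' [uE ->]]|[v' [-> wE]]] ->]]|[v [-> uE]]].
  + have [rx rv] : reduced x /\ reduced v'.
      move: ru; rewrite uE -mulgA => r; split; first exact: reducedL r.
      exact: reducedR (reducedR r).
    apply: (evaluates_eqw (evaluates_nest rx (mirror _ _ (evaluates_nest rv ew)))) => //.
    by rewrite uE !wbarM wbar_letter !mulgA.
  + apply: (evaluates_eqw (evaluates_nest ru (IHw _ _ (esym wE)))) => //.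
    by rewrite !mulgA.
  + have uE' : u = wbar y * letterw (linv a) * wbar v.
      by rewrite -[u]wbarK uE !wbarM wbar_letter mulgA.
    have [ry rv] : reduced (wbar y) /\ reduced (wbar v).
      move: ru; rewrite uE' -mulgA => r; split; first exact: reducedL r.
      exact: reducedR (reducedR r).
    have e1 := evaluates_nest rv ew; rewrite wbarK in e1.
    have e2 := evaluates_mul (evaluates_mul (evaluates_letter (linv a)) e1) ez.
    rewrite mulg1 mulVg in e2.
    apply: (evaluates_eqw (evaluates_nest ry e2)) => //.
    by rewrite uE' wbarK !mulgA.
Qed.

End Evaluation.

(** * Cut elimination *)

Section Invariance.
Set Implicit Arguments.
Unset Strict Implicit.
Local Open Scope group_scope.
Context {d : Order.disp_t} {Om : bOrderType d} {G : groupType} {Sg : set G}.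
Local Notation word := (word Om Sg).
Local Notation finw := (@finw _ Om _ Sg).
Local Notation letterw := (@wletter _ Om _ Sg).
Implicit Types (x y z p q u v w : word) (s t f k : seq (letter Sg)) (g h : G).

Lemma levi3 x m y p q : x * m * y = p * q ->
  [\/ exists z, p = x * m * z /\ y = z * q,
      exists m1 m2, [/\ m = m1 * m2, p = x * m1 & q = m2 * y]
    | exists z, x = p * z /\ q = z * m * y :> word].
Proof.
move/levi=> [[z [pE yE]]|[z [/levi[[z' [-> ->]]|[z' [xE zE]]] qE]]].
- by constructor 1; exists z.
- by constructor 2; exists z', z.
- by constructor 3; exists z'; rewrite qE zE.
Qed.

Lemma evaluates_insert x y z g :
  evaluates (x * y) g -> evaluates z 1 -> evaluates (x * z * y) g.
Proof.
case: (word_last x) => [->|[x' [a ->]]] exy ez.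
  rewrite !mul1g in exy *; rewrite -[g]mul1g; exact: evaluates_mul.
have e1 : evaluates (letterw a * z) (val a).
  by rewrite -[val a]mulg1; apply: evaluates_mul => //; exact: evaluates_letter.
by have := evaluates_subst_letter exy e1; rewrite !mulgA.
Qed.

(** A nonempty factor that is trivial in [G] cannot lie inside one of the two
    reduced arms of a nest; so it meets the core, and what remains of the arms
    on either side is still matched. *)
Lemma evaluates_delete_fin x f y g :
  evaluates (x * finw f * y) g -> feval f = 1 -> evaluates (x * y) g.
Proof.
move oE: (x * finw f * y) => o e f1; elim: e x y oE => {o g}
  [s|w w' g h ew IHw ew' IHw'|u w ru ew IHw] x y.
- move=> /esym/finw_eq_wmul[s1 [s2 [-> /esym/finw_eq_wmul[s3 [s4 [-> -> ]]]]]].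
  move=> /finw_inj <- ->; rewrite !feval_cat f1 mulg1.
  by apply: evaluates_mul => //; exact: evaluates_fin.
- move/levi3=> [[z [wE ->]]|[m1 [m2 [/finw_eq_wmul[s1 [s2 [fE -> ->]]] wE w'E]]]|[z [-> w'E]]].
  + by rewrite mulgA; apply: evaluates_mul (IHw _ _ (esym wE)) ew'.
  + rewrite wE in ew; rewrite w'E in ew'.
    apply: (evaluates_eqw (evaluates_mul (evaluates_divr ew) (evaluates_divl ew'))) => //.
    have -> : feval s2 = (feval s1)^-1.
      by apply: (mulgI (feval s1)); rewrite mulgV -feval_cat -fE.
    by rewrite invgK mulgA mulgVK.
  + by rewrite -mulgA; apply: evaluates_mul ew (IHw' _ _ (esym w'E)).
- have red r : reduced r -> forall p q, r = p * finw f * q -> f = [::].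
    move=> rr p q rE; apply: (@reduced_finw d Om G Sg f) f1.
    by apply: (@reduced_factor _ _ _ _ p _ q); rewrite -rE.
  move=> oE; move: (oE) => /levi3[[z [uwE yE]]|[m1 [m2 [fE uwE ubE]]]|[z [xE ubE]]]; last first.
  + move: oE; rewrite (red _ (reduced_bar ru) _ _ ubE) finw_nil mulg1 => ->.
    exact: evaluates_nest.
  + case/finw_eq_wmul: fE => [s1 [s2 [fE m1E m2E]]].
    rewrite fE feval_cat in f1.
    case/levi: uwE => [[z [xE wE]]|[z [uE m1z]]].
      rewrite m1E in wE; rewrite wE in ew; have ez := evaluates_divr ew.
      have uE : u = wbar y * wbar m2 by rewrite -[u]wbarK ubE wbarM.
      have ry : reduced (wbar y) by move: ru; rewrite uE; exact: reducedL.
      have := evaluates_mul (evaluates_fin (fbar s2)) ez.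
      rewrite mul1g feval_bar -invgM f1 invg1 -wbar_finw -m2E => e1.
      apply: (evaluates_eqw (evaluates_nest ry e1)) => //.
      by rewrite xE uE wbarK !mulgA.
    rewrite m1E in m1z; case/finw_eq_wmul: m1z => [s3 [s4 [s1E zE wE]]].
    have s4E : feval s4 = 1 by rewrite wE in ew; exact: evaluates_finw ew.
    rewrite s1E feval_cat s4E mulg1 in f1.
    have rx : reduced x by move: ru; rewrite uE; exact: reducedL.
    suff -> : y = wbar x.
      by have := evaluates_nest rx evaluates1; rewrite mulg1.
    rewrite uE wbarM zE m2E wbar_finw in ubE.
    have rubar : reduced (wbar (x * z)) by apply: reduced_bar; rewrite -uE.
    case/levi: ubE => [[z' [/finw_eq_wmul[s5 [s6 [s2E /finw_inj s5E z'E]]] xz]]|[z' [zz ->]]].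
      rewrite s2E -s5E feval_cat feval_bar mulVKg in f1.
      move: (xz); rewrite z'E (_ : s6 = [::]) ?finw_nil ?mul1g //.
      apply: (@reduced_finw d Om G Sg s6) f1; rewrite -z'E.
      by move: rubar; rewrite wbarM xz => /reducedR/reducedL.
    case/finw_eq_wmul: zz => [s5 [s6 [s3E /finw_inj s5E z'E]]].
    have : feval s3 * feval s2 = 1 by [].
    rewrite -[s3]fbarK s3E -s5E feval_bar feval_cat invgM mulgVK => f2.
    have f3 : feval s6 = 1 by rewrite -[feval s6]invgK f2 invg1.
    rewrite z'E (_ : s6 = [::]) ?finw_nil ?mul1g //.
    apply: (@reduced_finw d Om G Sg s6) f3.
    move: rubar; rewrite wbarM zE wbar_finw s3E finw_cat => /reducedL/reducedR //.
  + case/levi3: (esym uwE) => [[z' [uE zE]]|[m1 [m2 [/finw_eq_wmul[s1 [s2 [fE m1E m2E]]] uE wE]]]|[z' [xE wE]]].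
    * move: oE; rewrite (red _ ru _ _ uE) finw_nil mulg1 => ->.
      exact: evaluates_nest.
    * rewrite wE m2E in ew; have := evaluates_divl ew.
      move=> /evaluates_mul/(_ (evaluates_fin (fbar s1))).
      rewrite mulg1 feval_bar -invgM -feval_cat -fE f1 invg1 -wbar_finw -m1E => e1.
      have rx : reduced x by move: ru; rewrite uE; exact: reducedL.
      apply: (evaluates_eqw (evaluates_nest rx e1)) => //.
      by rewrite yE uE wbarM !mulgA.
    * apply: (evaluates_eqw (evaluates_nest ru (IHw _ _ (esym wE)))) => //.
      by rewrite xE yE !mulgA.
Qed.

Lemma evaluates_subst p k q a h :
  evaluates (p * finw k * q) h -> evaluates a (feval k) ->
  evaluates (p * a * q) h.
Proof.
move=> e ea; have e1 : evaluates (finw (fbar k) * a) 1.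
  have := evaluates_mul (evaluates_fin (fbar k)) ea.
  by rewrite feval_bar mulVg.
have e2 := evaluates_insert e e1.
have e3 : evaluates (p * finw (k ++ fbar k) * (a * q)) h.
  by apply: (evaluates_eqw e2) => //; rewrite finw_cat !mulgA.
have := evaluates_delete_fin e3; rewrite feval_cat feval_bar mulgV mulgA.
exact.
Qed.

Lemma evaluates_subst_fin p s t q h :
  evaluates (p * finw s * q) h -> feval s = feval t ->
  evaluates (p * finw t * q) h.
Proof. by move=> e st; apply: evaluates_subst e _; rewrite st; exact: evaluates_fin. Qed.

Lemma evaluates_word x g : evaluates x g -> exists s : seq (letter Sg), feval s = g.
Proof.
elim=> [s|{}x y {}g h _ [s <-] _ [t <-]|_ _ _ _ _]; first by exists s.
  by exists (s ++ t); rewrite feval_cat.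
by exists [::]; rewrite feval_nil.
Qed.

(** Cut elimination: [x] and [wbar u] differ by [g], so one may replace the
    other. The word [f] is inserted to correct the value, because a product
    cuts [x * u] into two parts whose values need not be trivial. *)
Lemma evaluates_cut x u z y g h f :
  evaluates (x * u) g -> reduced u -> evaluates (z * wbar u * y) h ->
  feval f = g^-1 -> evaluates (z * finw f * x * y) h.
Proof.
move oE: (x * u) => o e; elim: e x u z y f h oE => {o g}
  [s|w w' g1 g2 ew IHw ew' IHw'|v w rv ew IHw] x u z y f h.
- move=> /esym/finw_eq_wmul[s1 [s2 [-> -> uE]]] _.
  rewrite uE wbar_finw => e; rewrite feval_cat => fE.
  rewrite -(mulgA z) -finw_cat; apply: evaluates_subst_fin e _.
  by rewrite feval_bar feval_cat fE invgM mulgVK.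
- case/levi=> [[v [wE uE]]|[v [xE w'E]]] ru ez fE.
    have rv2 : reduced v by move: ru; rewrite uE; exact: reducedL.
    have rw' : reduced w' by move: ru; rewrite uE; exact: reducedR.
    have [s w's sE] := evaluates_reduced ew' rw'.
    have e2 : evaluates (z * wbar w' * wbar v * y) h.
      by apply: (evaluates_eqw ez) => //; rewrite uE wbarM !mulgA.
    have f1E : feval (s ++ f) = g1^-1 by rewrite feval_cat fE sE invgM mulVKg.
    have e3 : evaluates (z * finw (fbar s ++ (s ++ f)) * (x * y)) h.
      apply: (evaluates_eqw (IHw x v _ y _ h (esym wE) rv2 e2 f1E)) => //.
      by rewrite w's wbar_finw !finw_cat !mulgA.
    rewrite -mulgA; apply: evaluates_subst_fin e3 _.
    by rewrite !feval_cat feval_bar mulKg.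
  have [k kE] := evaluates_word ew.
  have [f2 f2E] : exists f2 : seq (letter Sg), feval f2 = g2^-1.
    by exists (f ++ k); rewrite feval_cat fE kE invgM mulgVK.
  have e1 := IHw' v u z y f2 h (esym w'E) ru ez f2E.
  have e2 : evaluates (z * finw (f ++ k) * (v * y)) h.
    rewrite -mulgA in e1; apply: evaluates_subst_fin e1 _.
    by rewrite feval_cat f2E fE kE invgM mulgVK.
  have e3 : evaluates (z * finw f * finw k * (v * y)) h.
    by apply: (evaluates_eqw e2) => //; rewrite finw_cat !mulgA.
  rewrite -kE in ew; apply: (evaluates_eqw (evaluates_subst e3 ew)) => //.
  by rewrite xE !mulgA.
- move=> oE ru ez fE.
  suff e : evaluates (z * (x * y)) h.
    have e1 : evaluates (finw f) 1 by have := evaluates_fin f; rewrite fE invg1.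
    by have := evaluates_insert e e1; rewrite !mulgA.
  move: oE; case/levi=> [[q [/levi[[r [xE wE]]|[r [vE qE]]] uE]]|[q [xE vbE]]].
  + have rq : reduced q by move: ru; rewrite uE; exact: reducedL.
    have ez' : evaluates (z * v * wbar q * y) h.
      by apply: (evaluates_eqw ez) => //; rewrite uE wbarM wbarK !mulgA.
    have e1 := IHw r q (z * v) y [::] h (esym wE) rq ez'.
    apply: (evaluates_eqw (e1 _)) => //; first by rewrite feval_nil invg1.
    by rewrite finw_nil mulg1 xE !mulgA.
  (* Here [u] swallows the core and part of the left arm; being reduced, it
     leaves no room for a core. *)
  + have r1 : r * w * wbar r = 1.
      have rr : reduced r by move: rv; rewrite vE; exact: reducedR.
      apply: evaluates_reduced1; first exact: evaluates_nest.
      move: ru; rewrite uE qE vE wbarM mulgA; exact: reducedL.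
    have {}uE : u = wbar x by rewrite uE qE vE wbarM mulgA r1 mul1g.
    by move: ez; rewrite uE wbarK mulgA.
  + have vE : v = wbar u * wbar q by rewrite -[v]wbarK vbE wbarM.
    have rq : reduced (wbar q) by move: rv; rewrite vE; exact: reducedR.
    have := evaluates_insert ez (evaluates_nest rq ew).
    by rewrite xE vE wbarK !mulgA.
Qed.

Lemma evaluates_cut_bar x u z y g h f :
  evaluates (u * x) g -> reduced u -> evaluates (z * wbar u * y) h ->
  feval f = g^-1 -> evaluates (z * x * finw f * y) h.
Proof.
move=> e ru ez fE; have e1 := evaluates_bar e; rewrite wbarM in e1.
have e2 := evaluates_bar ez; rewrite !wbarM mulgA in e2.
have e3 := evaluates_cut (f := fbar f) e1 (reduced_bar ru) e2.
have := evaluates_bar (e3 _); rewrite !invgK !wbarM !wbarK wbar_finw fbarK !mulgA.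
by apply; rewrite feval_bar fE invgK.
Qed.

(** A word with value 1 after [u] is an inverse of [u] on both sides: cut it
    against [wbar u * u]. *)
Lemma evaluates_rot u x : reduced u -> evaluates (u * x) 1 -> evaluates (x * u) 1.
Proof.
move=> ru e; have e1 : evaluates (1 * wbar u * u) 1.
  by have := evaluates_nest (reduced_bar ru) evaluates1; rewrite wbarK mulg1 mul1g.
have : evaluates (1 * x * finw [::] * u) 1.
  by apply: (evaluates_cut_bar e ru e1); rewrite feval_nil invg1.
by rewrite mul1g finw_nil mulg1.
Qed.

Lemma evaluates_rot' u x : reduced u -> evaluates (x * u) 1 -> evaluates (u * x) 1.
Proof.
move=> ru /evaluates_bar; rewrite wbarM invg1 => /(evaluates_rot (reduced_bar ru)).
by move/evaluates_bar; rewrite wbarM !wbarK invg1.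
Qed.

Lemma word_first x : x = 1 \/ exists a y, x = letterw a * y.
Proof.
case: (word_last (wbar x)) => [e|[y [a e]]].
  by left; rewrite -[x]wbarK e wbar1.
by right; exists (linv a), (wbar y); rewrite -wbar_letter -wbarM -e wbarK.
Qed.

(** Only the position of the centre of the deleted pair matters. It cannot lie
    strictly inside an arm of a nest, which is reduced; and if it lies in the
    core, the parts of the pair that reach into the arms match each other up
    to a trivial piece of the core. *)
Lemma evaluates_delete x u y g :
  evaluates (x * u * wbar u * y) g -> reduced u -> evaluates (x * y) g.
Proof.
move oE: (x * u * wbar u * y) => o e; elim: e x u y oE => {o g}
  [s|w w' g1 g2 ew IHw ew' IHw'|v w rv ew IHw] x u y.
- rewrite -2!mulgA => sE ru; move: (esym sE).
  move=> /finw_eq_wmul[s1 [s2 [-> ->]]].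
  move=> /esym/finw_eq_wmul[s3 [s4 [-> uE]]]; rewrite uE wbar_finw.
  move=> /esym/finw_eq_wmul[s5 [s6 [-> /finw_inj<- ->]]].
  rewrite !feval_cat feval_bar mulVKg.
  by apply: evaluates_mul => //; exact: evaluates_fin.
- rewrite -(mulgA x) => oE ru.
  have cut u1 u2 : u = u1 * u2 -> evaluates (x * u1) g1 ->
      evaluates (wbar u1 * y) g2 -> evaluates (x * y) (g1 * g2).
    move=> uE e1 e2; have ru1 : reduced u1 by move: ru; rewrite uE; exact: reducedL.
    have [s sE] : exists s : seq (letter Sg), feval s = g1.
      exact: evaluates_word ew.
    have e3 : evaluates (1 * wbar u1 * y) g2 by rewrite mul1g.
    have := @evaluates_cut x u1 1 y g1 g2 (fbar s) e1 ru1 e3.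
    rewrite mul1g -mulgA feval_bar sE => /(_ erefl)/evaluates_divl.
    by rewrite feval_bar invgK sE.
  case/levi3: oE => [[z [wE yE]]|[m1 [m2 [mE wE w'E]]]|[z [xE w'E]]].
  + rewrite yE mulgA; apply: evaluates_mul ew'; apply: IHw ru.
    by rewrite wE !mulgA.
  + case/levi: mE => [[z [m1E ubE]]|[z [uE m2E]]].
      have uE : u = wbar m2 * wbar z by rewrite -[u]wbarK ubE wbarM.
      apply: (cut _ _ uE); last by rewrite wbarK -w'E.
      rewrite -[x * wbar m2]mulg1; apply: (IHw _ (wbar z)); last first.
        by move: ru; rewrite uE; exact: reducedR.
      by rewrite wE m1E uE wbarK mulg1 !mulgA.
    apply: (cut _ _ uE); first by rewrite -wE.
    rewrite -[_ * y]mul1g; apply: (IHw' _ z); last first.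
      by move: ru; rewrite uE; exact: reducedR.
    by rewrite w'E m2E uE wbarM mul1g !mulgA.
  + rewrite xE -mulgA; apply: evaluates_mul ew _; apply: IHw' ru.
    by rewrite w'E !mulgA.
- rewrite -(mulgA x) => oE ru.
  have ex1 z : reduced z -> evaluates (z * wbar z) 1.
    by move=> rz; have := evaluates_nest rz evaluates1; rewrite mulg1.
  have inner w1 w2 : w = w1 * w2 -> x * u = v * w1 -> wbar u * y = w2 * wbar v ->
      evaluates (x * y) 1.
    move=> wE xuE uyE; case/levi: xuE => [[v2 [vE uE]]|[x1 [xE w1E]]].
      have rx : reduced x by move: rv; rewrite vE; exact: reducedL.
      have rv2 : reduced v2 by move: ru; rewrite uE; exact: reducedL.
      have rw1 : reduced w1 by move: ru; rewrite uE; exact: reducedR.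
      have ubE : wbar u = wbar w1 * wbar v2 by rewrite uE wbarM.
      case/levi: uyE => [[y1 [w2E yE]]|[v3 [ub2E vbE]]].
        have e1 : evaluates (1 * (wbar v2 * y1)) 1.
          apply: (IHw 1 w1); last exact: rw1.
          by rewrite mul1g wE w2E ubE !mulgA.
        rewrite mul1g in e1; have e2 := evaluates_rot (reduced_bar rv2) e1.
        apply: (evaluates_eqw (evaluates_nest rx e2)) => //.
        by rewrite yE vE wbarM !mulgA.
      have u2E : u = wbar v3 * wbar w2 by rewrite -[u]wbarK ub2E wbarM.
      suff v3E : wbar v3 = v2.
        have := vE; rewrite -[v]wbarK vbE wbarM v3E => /wmulIr <-.
        by rewrite -{2}[y]wbarK; apply: ex1; move: rv; rewrite -[v]wbarK vbE wbarM => /reducedL.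
      have := uE; rewrite u2E => /levi[[z [v2E w2E]]|[z [v3E w1E]]].
        have e1 : evaluates (1 * wbar z) 1.
          apply: (IHw 1 w1); last exact: rw1.
          by rewrite mul1g wE -[w2]wbarK w2E wbarM !mulgA.
        have rz : reduced z by move: rv2; rewrite v2E; exact: reducedR.
        rewrite mul1g in e1.
        have := evaluates_reduced1 e1 (reduced_bar rz).
        by move/(congr1 (@wbar _ _ _ _)); rewrite wbarK wbar1 v2E => ->; rewrite mulg1.
      have e1 : evaluates (z * 1) 1.
        apply: (IHw z (wbar w2)); first by rewrite wE w1E wbarK mulg1.
        by move: ru; rewrite u2E; exact: reducedR.
      rewrite mulg1 in e1.
      rewrite v3E (evaluates_reduced1 e1) ?mulg1 //.
      by move: rw1; rewrite w1E; exact: reducedL.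
    case/levi: uyE => [[y1 [w2E yE]]|[v3 [ub2E vbE]]].
      have e1 : evaluates (x1 * y1) 1.
        by apply: (IHw x1 u) => //; rewrite wE w1E w2E !mulgA.
      apply: (evaluates_eqw (evaluates_nest rv e1)) => //.
      by rewrite xE yE !mulgA.
    have u2E : u = wbar v3 * wbar w2 by rewrite -[u]wbarK ub2E wbarM.
    have v2E : v = wbar y * wbar v3 by rewrite -[v]wbarK vbE wbarM.
    have [ry rv3] : reduced (wbar y) /\ reduced (wbar v3).
      by move: rv; rewrite v2E => r; split; [exact: reducedL r|exact: reducedR r].
    have e1 : evaluates (x1 * wbar v3 * 1) 1.
      apply: (IHw _ (wbar w2)); first by rewrite wE w1E u2E wbarK mulg1 !mulgA.
      by move: ru; rewrite u2E; exact: reducedR.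
    rewrite mulg1 in e1; have e2 := evaluates_rot' rv3 e1.
    apply: (evaluates_eqw (evaluates_nest ry e2)) => //.
    by rewrite xE v2E wbarK !mulgA.
  case: (word_last u) => [u1|[u0 [a uE]]].
    move: oE; rewrite u1 wbar1 !mul1g mulg1 => ->; exact: evaluates_nest.
  have {}oE : v * w * wbar v = x * u * (wbar u * y) by rewrite -oE !mulgA.
  case/levi3: oE => [[z [xuE vbE]]|[m1 [m2 [wE xuE uyE]]]|[z [vE uyE]]].
  + case: (word_last z) => [z1|[z' [b zE]]].
      rewrite z1 mulg1 in xuE; rewrite z1 mul1g in vbE.
      by apply: (inner w 1); rewrite ?mulg1 ?mul1g.
    have /wmul_letter_inj[_ ab] : x * u0 * letterw a = v * w * z' * letterw b.
      by rewrite -mulgA -uE xuE zE !mulgA.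
    case: (@reduced_letterV _ _ _ _ z' a (wbar u0 * y)).
    move: (reduced_bar rv); rewrite vbE zE uE wbarM wbar_letter ab.
    by rewrite !mulgA.
  + exact: inner wE xuE uyE.
  + case: (word_first z) => [z1|[b [z' zE]]].
      rewrite z1 mul1g in uyE; rewrite z1 mulg1 in vE.
      by apply: (inner 1 w); rewrite ?mulg1 ?mul1g.
    have := uyE; rewrite uE zE wbarM wbar_letter -!mulgA => /eq_wmul[//|ab _].
    case: (@reduced_letterV _ _ _ _ (x * u0) a z').
    by move: rv; rewrite vE uE zE -ab !mulgA.
Qed.

End Invariance.

(** * Evaluation and reduction in the monoid *)

Section Reduction.
Set Implicit Arguments.
Unset Strict Implicit.
Local Open Scope group_scope.
Context {d : Order.disp_t} {Om : bOrderType d} {G : groupType} {Sg : set G}.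
Local Notation word := (word Om Sg).
Local Notation finw := (@finw _ Om _ Sg).
Local Notation letterw := (@wletter _ Om _ Sg).
Implicit Types (x y z p q u v w : word) (s t f k : seq (letter Sg)) (g h : G).

Lemma evaluates_mrel x y p q g : mrel x y ->
  evaluates (p * x * q) g <-> evaluates (p * y * q) g.
Proof.
case=> u [l [r [ru lr -> ->]]]; rewrite wbar_finw.
have f1 : feval (l ++ fbar r) = 1 by rewrite feval_cat feval_bar lr mulgV.
split=> e; last first.
  have e1 : evaluates (finw (l ++ fbar r)) 1 by rewrite -f1; exact: evaluates_fin.
  rewrite mulg1 in e; apply: (evaluates_eqw (evaluates_insert e (evaluates_nest ru e1))) => //.
  by rewrite finw_cat !mulgA.
have e1 : evaluates (p * u * finw (l ++ fbar r) * (wbar u * q)) g.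
  by apply: (evaluates_eqw e) => //; rewrite finw_cat !mulgA.
have := evaluates_delete_fin e1 f1; rewrite mulgA => /evaluates_delete/(_ ru).
by rewrite mulg1.
Qed.

Lemma evaluates_mcong x y : mcong x y -> forall g, evaluates x g <-> evaluates y g.
Proof.
elim=> [{}x {}y [p [q [l [r [lr -> ->]]]]] g|//|{}x {}y _ h g|{}x {}y z _ h1 _ h2 g].
- exact: evaluates_mrel lr.
- by rewrite h.
- by rewrite h1.
Qed.

Lemma mclass_finw s t : feval s = feval t -> mclass (finw s) = mclass (finw t).
Proof.
move=> st; have h a b : feval a = feval b -> mclass (finw a * wbar (finw b)) = 1.
  by move=> /(mclass_rel (reduced1 (Om := Om) (Sg := Sg))); rewrite mul1g wbar1 mulg1.
rewrite -[LHS]mulg1 -(h (fbar t) (fbar t) erefl) wbar_finw fbarK.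
by rewrite mclassM mulgA -wbar_finw -(mclassM (finw s)) (h _ _ st) mul1g.
Qed.

(** Values are therefore well defined on classes, and the inductive description
    of the elements of [G] in the monoid is exact. *)
Lemma evaluatesP x s : evaluates x (feval s) <-> mclass x = mclass (finw s).
Proof.
split; last first.
  move=> /esym/mclassP/evaluates_mcong h; apply/h; exact: evaluates_fin.
move gE: (feval s) => g e; elim: e s gE => {x g}
  [t|x y g h ex IHx ey IHy|u x ru ex IHx] s gE.
- exact: mclass_finw.
- have [k kE] := evaluates_word ex; have [l lE] := evaluates_word ey.
  rewrite mclassM (IHx k kE) (IHy l lE) -mclassM -finw_cat.
  by apply: mclass_finw; rewrite feval_cat kE lE.
- rewrite !mclassM (IHx [::] (feval_nil _)) finw_nil mulg1 -mclassM mclass_reduced //.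
  transitivity (mclass (finw [::])); first by rewrite finw_nil.
  by apply: mclass_finw; rewrite feval_nil.
Qed.

Lemma evaluatesE x g : evaluates x g ->
  exists2 s, feval s = g & mclass x = mclass (finw s).
Proof.
move=> e; have [s sE] := evaluates_word e; exists s => //.
by apply/evaluatesP; rewrite sE.
Qed.

Lemma evaluates_1 x : evaluates x 1 <-> mclass x = 1.
Proof. by have := evaluatesP x [::]; rewrite feval_nil finw_nil. Qed.

Lemma finw_1 s : mclass (finw s) = 1 -> feval s = 1.
Proof. by move/evaluates_1/evaluates_finw. Qed.

Section System.
Context (S0 : seq (letter Sg) -> seq (letter Sg) -> Prop) (aS0 : admissible S0).
Local Notation "x =>* y" := (sstar S0 x y) (at level 70, no associativity).
Local Notation fstar := (clos_refl_trans _ (rstep cat S0)).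

Lemma sstar_trans x y z : x =>* y -> y =>* z -> x =>* z.
Proof. exact: rt_trans. Qed.

Lemma sstar_refl x : x =>* x.
Proof. exact: rt_refl. Qed.

Lemma sstar_ctx p q x y : x =>* y -> p * x * q =>* p * y * q.
Proof.
elim=> [{}x {}y [p' [q' [l [r [Slr -> ->]]]]]|{}x|{}x {}y z _ h1 _ h2].
- apply: rt_step; exists (p * p'), (q' * q), l, r.
  by split; rewrite ?mulgA.
- exact: sstar_refl.
- exact: sstar_trans h1 h2.
Qed.

Lemma sstarM x x' y y' : x =>* x' -> y =>* y' -> x * y =>* x' * y'.
Proof.
move=> hx hy; apply: (@sstar_trans _ (x' * y)).
  by have := sstar_ctx 1 y hx; rewrite !mul1g.
by have := sstar_ctx x' 1 hy; rewrite !mulg1.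
Qed.

Lemma srule_bar x y : srule S0 x y -> srule S0 (wbar x) (wbar y).
Proof.
case=> [[l [r [lr -> ->]]]|[u [ru iu -> ->]]].
  by left; exists (fbar l), (fbar r); rewrite !wbar_finw; split=> //; exact: admissible_bar.
by right; exists u; rewrite wbarM wbarK wbar1.
Qed.

Lemma sstar_bar x y : x =>* y -> wbar x =>* wbar y.
Proof.
elim=> [{}x {}y [p' [q' [l [r [Slr -> ->]]]]]|{}x|{}x {}y z _ h1 _ h2].
- apply: rt_step; exists (wbar q'), (wbar p'), (wbar l), (wbar r).
  by split; rewrite ?wbarM ?mulgA //; exact: srule_bar.
- exact: sstar_refl.
- exact: sstar_trans h1 h2.
Qed.

Lemma sstar_finw s t : fstar s t -> finw s =>* finw t.
Proof.
elim=> [{}s {}t [p' [q' [l [r [Slr -> ->]]]]]|{}s|{}s {}t r _ h1 _ h2].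
- apply: rt_step; exists (finw p'), (finw q'), (finw l), (finw r).
  by split; rewrite ?finw_cat ?catA // -?mulgA //; left; exists l, r.
- exact: sstar_refl.
- exact: sstar_trans h1 h2.
Qed.

Lemma fstar_join s t : feval s = feval t ->
  exists2 r, fstar s r & fstar t r.
Proof.
move/(admissible_quotient aS0); elim=> [{}s {}t st|{}s|{}s {}t _ [r sr tr]|{}s {}t r _ [a sa ta] _ [b tb rb]].
- by exists t; [exact: rt_step|exact: rt_refl].
- by exists s; exact: rt_refl.
- by exists r.
- have [c ac bc] := admissible_confluent aS0 ta tb.
  by exists c; [exact: rt_trans ac|exact: rt_trans bc].
Qed.

Lemma sstar_join s t : feval s = feval t ->
  exists r, finw s =>* finw r /\ finw t =>* finw r.
Proof. by move=> /fstar_join[r sr tr]; exists r; split; exact: sstar_finw. Qed.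

Lemma fstar_nil r : fstar [::] r -> r = [::].
Proof.
move nE: [::] => n h; elim: h nE => // [s t st sE|s t r' _ h1 _ h2 nE].
  by case: (admissible_nil aS0 (y := t)); rewrite sE.
by have tE := h1 nE; rewrite h2 ?tE.
Qed.

Lemma sstar_fin1 s : feval s = 1 -> finw s =>* 1.
Proof.
move=> s1; have [|r sr nr] := @fstar_join s [::]; first by rewrite s1 feval_nil.
by rewrite -(@finw_nil d Om G Sg) -(fstar_nil nr); exact: sstar_finw.
Qed.

Lemma sstar_arms u : reduced u -> u * wbar u =>* 1.
Proof.
move=> ru; case: (pselect (infinite u)) => iu.
  apply: rt_step; exists 1, 1, (u * wbar u), 1; rewrite !mulg1 !mul1g; split=> //.
  by right; exists u.
have [s ->] : finite_word u by apply: contrapT => /infinite_wordP.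
rewrite wbar_finw -finw_cat; apply: sstar_fin1.
by rewrite feval_cat feval_bar mulgV.
Qed.

Lemma evaluates_sstar x g : evaluates x g ->
  exists s, [/\ x =>* finw s, feval s = g & (g = 1 -> x =>* 1)].
Proof.
have add x' s : x' =>* finw s -> feval s = 1 -> x' =>* 1.
  by move=> h /sstar_fin1; exact: sstar_trans.
elim=> [s|{}x y {}g h _ [s [xs sg _]] _ [t [yt th _]]|u {}x ru _ [s [_ _ x1]]].
- exists s; split=> //; [exact: sstar_refl|exact: sstar_fin1].
- have xy : x * y =>* finw (s ++ t) by rewrite finw_cat; exact: sstarM.
  exists (s ++ t); split; rewrite ?feval_cat ?sg ?th // => gh.
  by apply: add xy _; rewrite feval_cat sg th.
- have h : u * x * wbar u =>* 1.
    apply: (@sstar_trans _ (u * 1 * wbar u)); first exact: sstar_ctx (x1 erefl).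
    by rewrite mulg1; exact: sstar_arms.
  by exists [::]; rewrite finw_nil feval_nil.
Qed.

Lemma srule_mclass x y : srule S0 x y -> mclass x = mclass y.
Proof.
case=> [[l [r [lr -> ->]]]|[u [ru iu -> ->]]]; last exact: mclass_reduced.
apply: mclass_finw; apply/(admissible_quotient aS0); apply: rst_step.
by exists [::], [::], l, r; rewrite /= !cats0.
Qed.

Lemma sstar_mclass x y : x =>* y -> mclass x = mclass y.
Proof.
elim=> [{}x {}y [p' [q' [l [r [Slr -> ->]]]]]|//|{}x {}y z _ h1 _ h2].
- by rewrite !mclassM (srule_mclass Slr).
- by rewrite h1.
Qed.

End System.

End Reduction.

(** * Absorbed sides *)

Section Ears.
Set Implicit Arguments.
Unset Strict Implicit.
Local Open Scope group_scope.
Context {d : Order.disp_t} {Om : bOrderType d} {G : groupType} {Sg : set G}.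
Local Notation word := (word Om Sg).
Local Notation finw := (@finw _ Om _ Sg).
Implicit Types (x y z p q u v w : word) (L M : seq word).

Definition prodw L : word := \prod_(x <- L) x.

Lemma prodw_nil : prodw [::] = 1. Proof. exact: big_nil. Qed.

Lemma prodw_cons x L : prodw (x :: L) = x * prodw L.
Proof. exact: big_cons. Qed.

Lemma prodw_cat L M : prodw (L ++ M) = prodw L * prodw M.
Proof. exact: big_cat. Qed.

Lemma prodw_rcons L x : prodw (rcons L x) = prodw L * x.
Proof. by rewrite -cats1 prodw_cat prodw_cons prodw_nil mulg1. Qed.

Lemma prodw_cut L a b : L <> [::] -> prodw L = a * b ->
  exists L1 s t L2, [/\ L = L1 ++ (s * t) :: L2, a = prodw L1 * s &
    b = t * prodw L2].
Proof.
elim: L a b => // x L IHL a b _; rewrite prodw_cons => /levi[[z [aE LE]]|[z [xE bE]]].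
  have [L0|/(IHL _ _)] := pselect (L = [::]).
    exists [::], x, 1, [::]; move: LE; rewrite L0 !prodw_nil => /esym/wmul_eq1[z1 b1].
    by rewrite aE z1 b1 !mulg1 mul1g.
  move=> /(_ _ _ LE)[L1 [s [t [L2 [-> zE bE]]]]].
  by exists (x :: L1), s, t, L2; rewrite aE zE prodw_cons mulgA.
by exists [::], a, z, L; rewrite -xE prodw_nil mul1g bE.
Qed.

Definition has_value x : Prop := exists g, evaluates x g.

Lemma has_value_finw s : has_value (finw s).
Proof. by exists (feval s); exact: evaluates_fin. Qed.

Lemma has_value1 : has_value 1.
Proof. by exists 1; exact: evaluates1. Qed.

(** Cancellation is only asked up to an element of [G], so an empty half always
    qualifies, and absorption by a single neighbour is included. *)
Definition absorbed x y z : Prop := exists o p' p q q' o',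
  [/\ [/\ x = o * p', y = p * q & z = q' * o'], has_value (p' * p) &
      has_value (q * q')].

Definition ear L : Prop :=
  exists L1 x y z L2, L = L1 ++ [:: x, y, z & L2] /\ absorbed x y z.

Lemma absorbed_left o x p y : has_value (x * y) -> absorbed (o * x) y p.
Proof.
by exists o, x, y, 1, 1, p; split; rewrite ?mulg1 ?mul1g //; exact: has_value1.
Qed.

Lemma absorbed_right o x p y : has_value (y * x) -> absorbed p y (x * o).
Proof.
by exists p, 1, 1, y, x, o; split; rewrite ?mulg1 ?mul1g //; exact: has_value1.
Qed.

Lemma absorbed1 x y : absorbed x 1 y.
Proof.
by rewrite -[x]mulg1; apply: absorbed_left; rewrite mulg1; exact: has_value1.
Qed.

Lemma ear_widenr L s t M : ear (rcons L s) -> ear (L ++ (s * t) :: M).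
Proof.
case=> L1 [x [y [z [L2 [LE]]]]]; case/lastP: L2 LE => [|L2 a] LE.
  move: LE; rewrite -2!cat_rcons cats1 => /rcons_inj[-> ->] h.
  exists L1, x, y, (z * t), M; split; first by rewrite -!cats1 -!catA.
  case: h => o [p' [p [q [q' [o' [[-> -> ->] h1 h2]]]]]].
  by exists o, p', p, q, q', (o' * t); rewrite mulgA.
move: LE; rewrite -!rcons_cons -rcons_cat => /rcons_inj[-> _] h.
exists L1, x, y, z, (L2 ++ (s * t) :: M); split=> //.
by rewrite -catA.
Qed.

Lemma ear_widenl L s t M : ear (t :: M) -> ear (L ++ (s * t) :: M).
Proof.
case=> [[|a L1]] [x [y [z [L2 [[-> ->]]]]]] h.
  exists L, (s * x), y, z, L2; split=> //.
  case: h => o [p' [p [q [q' [o' [[-> -> ->] h1 h2]]]]]].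
  by exists (s * o), p', p, q, q', o'; rewrite mulgA.
by exists (L ++ (s * a) :: L1), x, y, z, L2; rewrite -catA.
Qed.

(** The core of a nest consists here of the end of one side and the beginning
    of the next. The arms continue into both sides; the one that leaves its
    side first finds its whole side cancelled against the other. *)
Lemma ear_adjacent L s t s' t' M v : (0 < size L + size M)%N ->
  reduced v -> v = prodw L * s -> wbar v = t' * prodw M ->
  evaluates (t * s') 1 -> ear (L ++ [:: s * t, s' * t' & M]).
Proof.
move=> sLM rv vE vbE e.
have v2E : v = wbar (prodw M) * wbar t' by rewrite -[v]wbarK vbE wbarM.
have rs : reduced s by move: rv; rewrite vE; exact: reducedR.
have rt : reduced (wbar t') by move: rv; rewrite v2E; exact: reducedR.
have es : has_value (s * t * (s' * wbar s)).
  by exists 1; apply: (evaluates_eqw (evaluates_nest rs e)); rewrite // !mulgA.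
have et : has_value (wbar t' * t * (s' * t')).
  exists 1; apply: (evaluates_eqw (evaluates_nest rt e)) => //.
  by rewrite wbarK !mulgA.
move: v2E; rewrite vE => /levi[[z [ME sE]]|[z [LE tE]]].
  case: M sLM ME {vbE} => [|y M] sLM ME.
    move: ME; rewrite prodw_nil wbar1 => /esym/wmul_eq1[_ z1].
    case/lastP: L sLM {vE} => // L x _.
    rewrite sE z1 mul1g; exists L, x, (wbar t' * t), (s' * t'), [::].
    split; first by rewrite -cats1 -catA.
    by rewrite -[s' * t']mulg1; apply: absorbed_right.
  exists L, (s * t), (s' * t'), y, M; split=> //.
  by rewrite sE -mulgA; apply: absorbed_left.
have t'E : t' = wbar s * wbar z by rewrite -[t']wbarK tE wbarM.
case/lastP: L sLM LE {vE} => [|L x] sLM LE.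
  move: LE; rewrite prodw_nil => /esym/wmul_eq1[_ z1].
  case: M sLM {vbE} => // y M _.
  rewrite t'E z1 wbar1 mulg1; exists [::], (s * t), (s' * wbar s), y, M.
  split=> //; by rewrite -[s * t]mul1g; apply: absorbed_left.
exists L, x, (s * t), (s' * t'), M; split; first by rewrite -cats1 -catA.
by rewrite t'E mulgA; apply: absorbed_right.
Qed.

(** The combinatorial core: cancellation in a product is planar, and a planar
    pairing of the sides of a polygon has a side paired with its two
    neighbours only. The bound on the number of sides leaves an inner one. *)
Lemma evaluates_ear L g : evaluates (prodw L) g -> (2 < size L)%N -> ear L.
Proof.
move XE: (prodw L) => X e; elim: e L XE => {X g}
  [s|x y g h ex IHx ey IHy|v w rv ew IHw] L LE sL.
- case: L LE sL => [|x [|y [|z L]]] //; rewrite !prodw_cons => LE _.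
  exists [::], x, y, z, L; split=> //.
  have /finite_wmul[_ /finite_wmul[[t ->] _]] : finite_word (x * (y * (z * prodw L))).
    by exists s.
  rewrite -[x]mulg1; apply: absorbed_left; rewrite mul1g; exact: has_value_finw.
- have L0 : L <> [::] by case: (L) sL.
  have [L1 [s [t [L2 [LLE xE yE]]]]] := prodw_cut L0 LE.
  rewrite LLE; case: (ltnP 1 (size L1)) => s1.
    by apply: ear_widenr; apply: IHx; rewrite ?prodw_rcons ?size_rcons.
  case: (ltnP 1 (size L2)) => s2.
    by apply: ear_widenl; apply: IHy; rewrite ?prodw_cons.
  move: sL; rewrite LLE size_cat /= addnS ltnS.
  case: L1 s1 xE {LLE} => [|a [|? ?]] // _ xE; first by rewrite add0n ltnNge s2.
  case: L2 s2 yE => [|b [|? ?]] // _ yE _.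
  exists [::], a, (s * t), b, [::]; split=> //; exists 1, a, s, t, b, 1.
  rewrite mulg1 mul1g; split=> //.
    by exists g; rewrite prodw_cons prodw_nil mulg1 in xE; rewrite -xE.
  by exists h; rewrite prodw_cons prodw_nil mulg1 in yE; rewrite -yE.
- have L0 : L <> [::] by case: (L) sL.
  rewrite -mulgA in LE; have [L1 [s [t [L2 [LLE vE wE]]]]] := prodw_cut L0 LE.
  have [M1 [s' [t' [M2 [tLE {}wE vbE]]]]] : exists M1 s' t' M2,
      [/\ t :: L2 = M1 ++ s' * t' :: M2, w = prodw M1 * s' & wbar v = t' * prodw M2].
    by apply: prodw_cut; rewrite // prodw_cons wE.
  case: M1 tLE wE => [[tE L2E] wE|a M1 [<- L2E] wE].
    (* The core lies inside one side: widen it along the arms until it reaches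
       an end of that side. *)
    move: LLE sL vE; rewrite {}tE {}L2E {L2 t LE L0}; move: M2 vbE => L2 vbE LLE sL vE.
    rewrite prodw_nil mul1g in wE; rewrite -{}wE {s'} in LLE.
    have v2E : v = wbar (prodw L2) * wbar t' by rewrite -[v]wbarK vbE wbarM.
    have rs : reduced s by move: rv; rewrite vE; exact: reducedR.
    have rt : reduced (wbar t') by move: rv; rewrite v2E; exact: reducedR.
    rewrite LLE; move: sL; rewrite LLE size_cat /= addnS ltnS => sL.
    move: (v2E); rewrite vE => /levi[[z [LE sE]]|[z [LE tE]]].
      have et : evaluates (wbar t' * w * t') 1.
        by have := evaluates_nest rt ew; rewrite wbarK.
      case: L2 LE sL {vbE v2E LLE} => [|y L2] LE sL.
        move: LE; rewrite prodw_nil wbar1 => /esym/wmul_eq1[LE _].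
        case/lastP: L1 sL LE {vE} => // L1 x; case/lastP: L1 => // L1 y _.
        rewrite !prodw_rcons => /wmul_eq1[_ ->].
        exists L1, y, 1, (s * (w * t')), [::]; split; last exact: absorbed1.
        by rewrite -!cats1 -!catA.
      have := @ear_adjacent L1 z (wbar t' * w * t') 1 y L2 (prodw L1 * z).
      rewrite mul1g mulg1 -[_ * w * t']mulgA !mulgA -sE -!mulgA; apply=> //.
      + by move: sL; rewrite /= addnS ltnS.
      + by move: rv; rewrite vE sE mulgA; exact: reducedL.
      + by rewrite -LE wbarK prodw_cons.
      + by rewrite mulgA.
    have t'E : t' = wbar s * wbar z by rewrite -[t']wbarK tE wbarM.
    have es := evaluates_nest rs ew.
    case/lastP: L1 LE sL vE {LLE} => [|L1 x] LE sL vE.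
      move: LE; rewrite prodw_nil => /esym/wmul_eq1[LE _].
      have : prodw L2 = 1 by rewrite -[prodw L2]wbarK LE wbar1.
      case: L2 sL {vbE v2E LE} => [|x [|y L2]] // _; rewrite prodw_cons => /wmul_eq1[-> _].
      by exists [::], (s * (w * t')), 1, y, L2; split=> //; exact: absorbed1.
    have := @ear_adjacent L1 x 1 (s * w * wbar s) (wbar z) L2 (prodw (rcons L1 x)).
    rewrite mulg1 mul1g t'E cat_rcons !mulgA; apply=> //.
    + by move: sL; rewrite size_rcons addSn.
    + by move: rv; rewrite vE; exact: reducedL.
    + by rewrite prodw_rcons.
    + by rewrite LE wbarM wbarK.
  rewrite LLE L2E; case: M1 wE L2E => [wE L2E|b M1 wE L2E].
    apply: ear_adjacent rv vE vbE _; last first.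
      by move: ew; rewrite wE prodw_cons prodw_nil mulg1.
    by move: sL; rewrite LLE L2E size_cat /= !addnS.
  apply: ear_widenl; rewrite -cat_cons; apply: ear_widenr.
  apply: IHw; first by rewrite prodw_rcons.
  by rewrite size_rcons.
Qed.

End Ears.

(** * Tight words and ladders *)

Section Ladders.
Set Implicit Arguments.
Unset Strict Implicit.
Local Open Scope group_scope.
Context {d : Order.disp_t} {Om : bOrderType d} {G : groupType} {Sg : set G}.
Context (Sg1 : forall a : G, Sg a -> a <> 1).
Local Notation A := (ogroup Om).
Local Notation word := (word Om Sg).
Local Notation finw := (@finw _ Om _ Sg).
Implicit Types (x y z p q u v w : word) (s t f k : seq (letter Sg)) (g h : G).

Lemma rstar_wmul x y : rstar (x * y) -> rstar x /\ rstar y.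
Proof.
move zE: (x * y) => z rz; elim: rz x y zE => {z}
  [x y /wmul_eq1[-> ->]|u ru x y uE|a b ra IHa rb IHb x y].
- by split; exact: rstar1.
- by rewrite -uE in ru; split; apply: rstar_reduced; [exact: reducedL ru|exact: reducedR ru].
- case/levi=> [[z [aE ->]]|[z [-> bE]]].
    by have [] := IHa _ _ (esym aE); split=> //; exact: rstarM.
  by have [] := IHb _ _ (esym bE); split=> //; exact: rstarM.
Qed.

Lemma rstar_bar x : rstar x -> rstar (wbar x).
Proof. by case/mclass_rstar. Qed.

Lemma mclass_barr x : rstar x -> mclass x * mclass (wbar x) = 1.
Proof. by case/mclass_rstar=> _; rewrite mclassM. Qed.

Lemma mclass_barl x : rstar x -> mclass (wbar x) * mclass x = 1.
Proof. by move/rstar_bar/mclass_barr; rewrite wbarK. Qed.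

(** Reducedness modulo finite words: the reductions below keep multiplying
    reduced words by finite ones, which spoils reducedness but not this. *)
Definition tight x : Prop := rstar x /\
  forall p z q g, x = p * z * q -> evaluates z g -> finite_word z.

Lemma tight_wmul x y : tight (x * y) -> tight x /\ tight y.
Proof.
case=> /rstar_wmul[rx ry] h; split; split=> // p z q g e; apply: h.
  by rewrite e -[_ * q * y]mulgA.
by rewrite e !mulgA.
Qed.

Lemma tight_reduced u : reduced u -> tight u.
Proof.
move=> ru; split; first exact: rstar_reduced.
move=> p z q g uE e; have rz : reduced z by move: ru; rewrite uE; exact: reduced_factor.
by have [s ->] := evaluates_reduced e rz; exists s.
Qed.

Lemma tight_bar x : tight x -> tight (wbar x).
Proof.
case=> rx h; split; first exact: rstar_bar.
move=> p z q g xE /evaluates_bar e; apply/finite_wbar; apply: h e.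
by rewrite -[x]wbarK xE !wbarM mulgA.
Qed.

Lemma tight_finl s x : tight x -> tight (finw s * x).
Proof.
case=> rx h; split; first by apply: rstarM => //; exact: rstar_finw.
move=> p z q g /esym/levi3[[r [sE _]]|[m1 [m2 [zE sE xE]]]|[r [_ xE]]] e.
- have /finite_wmul[/finite_wmul[]] // : finite_word (p * z * r) by exists s.
- have /finite_wmul[_ [t m1E]] : finite_word (p * m1) by exists s.
  rewrite zE m1E in e *; apply: finite_wmulI; first exact: finite_finw.
  by apply: (h 1 m2 q _ _ (evaluates_divl e)); rewrite xE mul1g.
- exact: h xE e.
Qed.

Lemma tight_finr s x : tight x -> tight (x * finw s).
Proof.
move=> /tight_bar/(tight_finl (fbar s))/tight_bar.
by rewrite wbarM wbarK wbar_finw fbarK.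
Qed.

(** The normal form of a cancellation between two tight words: matching reduced
    blocks separated by finite words whose products are trivial, except for the
    outermost one. *)
Inductive ladder : word -> word -> G -> Prop :=
| ladder_fin s t : ladder (finw s) (finw t) (feval s * feval t)
| ladder_step s v x y t : reduced v -> ladder x y 1 ->
    ladder (finw s * v * x) (y * wbar v * finw t) (feval s * feval t).

Lemma ladder_eq x y x' y' g g' :
  ladder x y g -> x = x' -> y = y' -> g = g' -> ladder x' y' g'.
Proof. by move=> + <- <- <-. Qed.

Lemma ladder_finl s x y g : ladder x y g -> ladder (finw s * x) y (feval s * g).
Proof.
case=> [s' t|s' v x' y' t rv l].
  by apply: (ladder_eq (ladder_fin (s ++ s') t)); rewrite ?finw_cat ?feval_cat ?mulgA.
by apply: (ladder_eq (ladder_step (s ++ s') t rv l)); rewrite ?finw_cat ?feval_cat ?mulgA.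
Qed.

Lemma ladder_finr t x y g : ladder x y g -> ladder x (y * finw t) (g * feval t).
Proof.
case=> [s t'|s v x' y' t' rv l].
  by apply: (ladder_eq (ladder_fin s (t' ++ t))); rewrite ?finw_cat ?feval_cat ?mulgA.
by apply: (ladder_eq (ladder_step s (t' ++ t) rv l)); rewrite ?finw_cat ?feval_cat ?mulgA.
Qed.

Lemma ladder_block v x y : reduced v -> ladder x y 1 -> ladder (v * x) (y * wbar v) 1.
Proof.
move=> rv l; apply: (ladder_eq (ladder_step [::] [::] rv l)).
- by rewrite finw_nil mul1g.
- by rewrite finw_nil mulg1.
- by rewrite feval_nil mulg1.
Qed.

Lemma ladder_fin1 s : feval s = 1 -> ladder (finw s) 1 1 /\ ladder 1 (finw s) 1.
Proof.
move=> s1; have := ladder_fin s [::]; have := ladder_fin [::] s.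
by rewrite finw_nil feval_nil s1 mulg1.
Qed.

Lemma evaluates_ladder x y g :
  evaluates (x * y) g -> tight x -> tight y -> ladder x y g.
Proof.
move zE: (x * y) => z e; elim: e x y zE => {z g}
  [s|a b g h ea IHa eb IHb|v w rv ew IHw] x y.
- move=> /esym/finw_eq_wmul[s1 [s2 [-> -> ->]]] _ _.
  rewrite feval_cat; exact: ladder_fin.
- case/levi=> [[z [aE yE]]|[z [xE bE]]] tx ty.
    have [t bt] : finite_word b.
      by case: ty => _ ty; apply: (ty z b 1 _ _ eb); rewrite mulg1.
    rewrite bt in eb; rewrite yE bt -(evaluates_finw eb); apply: ladder_finr.
    by apply: IHa => //; move: ty; rewrite yE => /tight_wmul[].
  have [s sE] : finite_word a.
    by case: tx => _ tx; apply: (tx 1 a z _ _ ea); rewrite mul1g.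
  rewrite sE in ea; rewrite xE sE -(evaluates_finw ea); apply: ladder_finl.
  by apply: IHb => //; move: tx; rewrite xE => /tight_wmul[].
- move=> xyE tx ty.
  have core r : reduced r -> (tight (r * w * wbar r) -> exists2 s, r * w * wbar r = finw s & feval s = 1).
    move=> rr [_ tr]; have e := evaluates_nest rr ew.
    have [s sE] : finite_word (r * w * wbar r).
      by apply: (tr 1 _ 1 _ _ e); rewrite mulg1 mul1g.
    by exists s => //; rewrite sE in e; exact: evaluates_finw e.
  case/levi: xyE => [[z [/levi[[r [xE wE]]|[r [vE wE]]] yE]]|[z [xE vE]]].
  + rewrite xE yE; apply: ladder_block rv _; apply: IHw => //.
      by move: tx; rewrite xE => /tight_wmul[].
    by move: ty; rewrite yE => /tight_wmul[].
  + have rr : reduced r by move: rv; rewrite vE; exact: reducedR.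
    have rx : reduced x by move: rv; rewrite vE; exact: reducedL.
    have {}yE : y = r * w * wbar r * wbar x by rewrite yE wE vE wbarM !mulgA.
    have [|s sE s1] := core r rr; first by move: ty; rewrite yE => /tight_wmul[].
    rewrite yE sE -{1}[x]mulg1; apply: ladder_block => //.
    by case: (ladder_fin1 s1).
  + have {}vE : v = wbar y * wbar z by rewrite -[v]wbarK vE wbarM.
    have rz : reduced (wbar z) by move: rv; rewrite vE; exact: reducedR.
    have ry : reduced (wbar y) by move: rv; rewrite vE; exact: reducedL.
    have {}xE : x = wbar y * (wbar z * w * wbar (wbar z)) by rewrite xE vE wbarK !mulgA.
    have [|s sE s1] := core (wbar z) rz; first by move: tx; rewrite xE => /tight_wmul[].
    rewrite xE sE -[y in ladder _ y _]wbarK -[wbar (wbar y)]mul1g; apply: ladder_block => //.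
    by case: (ladder_fin1 s1).
Qed.

Lemma ladder_evaluates x y g : ladder x y g -> evaluates (x * y) g.
Proof.
elim=> [s t|s v {}x {}y t rv _ e]; first by apply: evaluates_mul; exact: evaluates_fin.
have := evaluates_mul (evaluates_mul (evaluates_fin s) (evaluates_nest rv e)) (evaluates_fin t).
by rewrite mulg1 !mulgA.
Qed.

(** A cut inside a block is mirrored in the partner of the block; a cut inside
    a finite word may be moved to the start of the next block, at the cost of
    a finite word. *)
Lemma ladder_cut x y g a b : ladder x y g -> x = a * b ->
  exists y1 y2, y = y1 * y2 /\ has_value (b * y1).
Proof.
move=> l; elim: l a b => {x y g} [s t|s v x y t rv l IHl] a b.
  move/finw_eq_wmul=> [s1 [s2 [_ _ ->]]]; exists 1, (finw t); rewrite mul1g mulg1.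
  by split=> //; exact: has_value_finw.
have e := ladder_evaluates l.
case/levi=> [[z [_ xE]]|[z [svE ->]]].
  have [y1 [y2 [-> h]]] := IHl _ _ xE.
  by exists y1, (y2 * wbar v * finw t); rewrite !mulgA.
case/levi: svE => [[r [_ vE]]|[r [/finw_eq_wmul[s1 [s2 [_ _ ->]]] ->]]].
  exists (y * wbar z), (wbar r * finw t); split; first by rewrite vE wbarM !mulgA.
  have rz : reduced z by move: rv; rewrite vE; exact: reducedR.
  by exists 1; apply: (evaluates_eqw (evaluates_nest rz e)); rewrite // !mulgA.
exists (y * wbar v), (finw t); split=> //; exists (feval s2 * 1).
apply: (evaluates_eqw (evaluates_mul (evaluates_fin s2) (evaluates_nest rv e))) => //.
by rewrite !mulgA.
Qed.

(** The two sides of a ladder agree in length only up to the finite words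
    between the blocks, so lengths are compared modulo [t0]. *)
Definition near (a b : A) : Prop := exists n, a = (b + t0 *~ n)%R.

Lemma near_sym a b : near a b -> near b a.
Proof. by case=> n ->; exists (- n)%R; rewrite ssrint.mulrNz GRing.addrK. Qed.

Lemma near_trans b a c : near a b -> near b c -> near a c.
Proof.
by move=> [n ->] [m ->]; exists (m + n)%R; rewrite ssrint.mulrzDr GRing.addrA.
Qed.

Lemma near_refl a : near a a.
Proof. by exists 0%R; rewrite ssrint.mulr0z GRing.addr0. Qed.

Lemma near_add a b a' b' : near a b -> near a' b' -> near (a + a')%R (b + b')%R.
Proof.
by move=> [n ->] [m ->]; exists (n + m)%R; rewrite ssrint.mulrzDr GRing.addrACA.
Qed.

Lemma near_cancel a b a' b' : near (a + b)%R (a' + b')%R -> near a a' -> near b b'.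
Proof.
move=> ab /near_sym/(near_add (near_refl (- a)%R)) e.
have {e} [k e] : near (- a + a')%R 0%R.
  by case: e => k e; exists k; move: e; rewrite GRing.addNr.
have := near_add (near_refl (- a)%R) ab; rewrite !GRing.addrA GRing.addNr GRing.add0r e.
move/near_trans; apply; exists k; by rewrite GRing.add0r GRing.addrC.
Qed.

Lemma near_finite x : near (wlen x) 0%R -> finite_word x.
Proof.
case=> [[n|n]]; rewrite GRing.add0r => e; first by apply/finite_wordP; exists n.
have e0 : (wlen x + t0 *+ n.+1 = 0)%R by rewrite e GRing.addNr.
apply/finite_wordP; apply: (@ogroup_le_nat _ _ _ 0%N); first exact: wlen_ge0.
rewrite GRing.mulr0n -e0 -{1}[wlen x]GRing.addr0 ogroup_leD2l.
exact: Order.POrderTheory.ltW (mulr_t0_gt Om n).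
Qed.

Lemma near_finw s : near (wlen (finw s)) 0%R.
Proof. by exists (Posz (size s)); rewrite wlen_finw GRing.add0r. Qed.

Lemma ladder_near x y g : ladder x y g -> near (wlen x) (wlen y).
Proof.
elim=> [s t|s v {}x {}y t _ _ h].
  by apply: near_trans (near_finw s) (near_sym (near_finw t)).
rewrite !wlenM wlen_bar -GRing.addrA GRing.addrC [(wlen v + _)%R]GRing.addrC.
apply: near_add; last by apply: near_trans (near_finw s) (near_sym (near_finw t)).
by apply: near_add (near_refl _).
Qed.

Lemma near_finite_eq1 x y : near (wlen (x * y)) (wlen y) -> finite_word x.
Proof.
rewrite wlenM -{2}[wlen y]GRing.add0r GRing.addrC [(0 + _)%R]GRing.addrC => h.
exact: near_finite (near_cancel h (near_refl _)).
Qed.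

End Ladders.

(** * Centres and centralizers *)

Section Centres.
Set Implicit Arguments.
Unset Strict Implicit.
Local Open Scope ring_scope.
Local Open Scope group_scope.
Context {d : Order.disp_t} {Om : bOrderType d} {G : groupType} {Sg : set G}.
Context (Sg1 : forall a : G, Sg a -> a <> 1).
Context (S0 : seq (letter Sg) -> seq (letter Sg) -> Prop) (aS0 : admissible S0).
Local Notation "x =>* y" := (sstar S0 x y) (at level 70, no associativity).
Local Notation A := (ogroup Om).
Local Notation word := (word Om Sg).
Local Notation finw := (@finw _ Om _ Sg).
Implicit Types (x y z p q u v w : word) (s t f k : seq (letter Sg)) (g h : G).

(** Finite words facing each other in a ladder have inverse values in [G], so
    confluence and the symmetry of [S0] reduce them to mirror images. *)
Lemma ladder_join x y : ladder x y 1 ->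
  exists z, [/\ rstar z, y =>* z & x =>* wbar z].
Proof.
move gE: 1 => g l; elim: l gE => {x y g} [s t|s v x y t rv _ IHl] /esym gE.
all: have [r [sr tr]] : exists r, finw (fbar s) =>* finw r /\ finw t =>* finw r.
1,3: apply: (sstar_join aS0); rewrite feval_bar; apply: (mulgI (feval s));
  by rewrite gE mulgV.
all: have {}sr : finw s =>* finw (fbar r)
  by rewrite -[s]fbarK -!wbar_finw; apply: sstar_bar aS0 _ _ _; rewrite wbar_finw.
  by exists (finw r); split=> //; [exact: rstar_finw|rewrite wbar_finw].
have [z [rz yz xz]] := IHl erefl.
exists (z * wbar v * finw r); split.
- apply: rstarM; last exact: rstar_finw.
  by apply: rstarM => //; apply: rstar_bar; exact: rstar_reduced.
- by apply: sstarM => //; apply: sstarM => //; exact: sstar_refl.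
- rewrite !wbarM wbarK wbar_finw mulgA.
  by apply: sstarM => //; apply: sstarM => //; exact: sstar_refl.
Qed.

Lemma ladder_arms x y g : ladder x y g ->
  exists z s t, [/\ rstar z, y =>* z * finw t & x =>* finw s * wbar z].
Proof.
case=> [s t|s v x' y' t rv /ladder_join[z [rz yz xz]]].
  exists 1, s, t; rewrite wbar1 mul1g mulg1; split; try exact: sstar_refl.
  exact: rstar1.
exists (z * wbar v), s, t; split.
- by apply: rstarM => //; apply: rstar_bar; exact: rstar_reduced.
- by rewrite -!mulgA; apply: sstarM => //; exact: sstar_refl.
- by rewrite wbarM wbarK mulgA; apply: sstarM => //; exact: sstar_refl.
Qed.

Definition self_inverse_reduct x : Prop := exists2 y, x =>* y & y = wbar y.

Definition finite_conjugate x : Prop :=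
  exists c s, rstar c /\ mclass x = mclass (c * finw s * wbar c).

Lemma self_inverse_conj x y z :
  x =>* z * y * wbar z -> self_inverse_reduct y -> self_inverse_reduct x.
Proof.
move=> xy [y' yy' y'E]; exists (z * y' * wbar z).
  by apply: sstar_trans xy _; exact: sstar_ctx.
by rewrite !wbarM wbarK -y'E mulgA.
Qed.

Lemma levi_ler x y p q : x * y = p * q -> wlen q <= wlen y ->
  exists z, y = z * q /\ p = x * z.
Proof.
move=> e qy; have e' : wbar q * wbar p = wbar y * wbar x by rewrite -!wbarM e.
have [z [yE pE]] := levi_le e' qy.
by exists (wbar z); rewrite -[y]wbarK -[p]wbarK yE pE !wbarM !wbarK.
Qed.

(** The word [X] ends with [x], begins with [y], and these two cover it. Descend
    the ladder, from the ends of [X] towards its middle, until [x] and [y] leave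
    a gap [M]. The block [v] dropped last covers at least the half of [M] from
    both sides, up to finitely many letters. *)
Lemma ladder_centre X : rstar X -> forall x y, ladder x y 1 ->
  forall l r, X = l * x -> X = y * r -> wlen X <= wlen x + wlen y ->
  self_inverse_reduct X \/ finite_conjugate X.
Proof.
move=> rX x y; move gE: 1 => g lad.
elim: lad gE => {x y g} [s t|s v x y t rv lxy IHl] gE l r Xl Xr leX.
  right; have [k XE] : finite_word X.
    apply/finite_wordP; apply: (@ogroup_le_nat _ _ _ (size s + size t)).
      exact: wlen_ge0.
    by rewrite GRing.mulrnDr -!wlen_finw.
  by exists 1, k; rewrite wbar1 mulg1 mul1g -XE; split=> //; exact: rstar1.
have {}IHl := IHl erefl.
have Xl' : X = l * finw s * v * x by rewrite Xl !mulgA.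
have Xr' : X = y * (wbar v * (finw t * r)) by rewrite Xr !mulgA.
case: (boolP (wlen X <= wlen x + wlen y)) => [leX'|].
  exact: IHl Xl' Xr' leX'.
rewrite -Order.TotalTheory.ltNge => gtX.
have [M [LE RE]] : exists M, l * finw s * v = y * M /\
    wbar v * (finw t * r) = M * x.
  apply: levi_le; first by rewrite -Xr' -Xl'.
  rewrite -(ogroup_leD2r (wlen x)) -[X in _ <= X]wlenM -Xl' GRing.addrC.
  exact: Order.POrderTheory.ltW.
have XE : X = y * M * x by rewrite Xl' LE.
have [z [rz yz xz]] := ladder_join lxy.
have mirror M' : M = M' -> M' = wbar M' -> self_inverse_reduct X.
  move=> MM' M'E; apply: (@self_inverse_conj _ M' z); last by exists M' => //; exact: sstar_refl.
  by rewrite XE MM'; apply: sstarM => //; apply: sstarM => //; exact: sstar_refl.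
case: (Order.TotalTheory.leP (wlen M) (wlen v)) => [Mv|/Order.POrderTheory.ltW vM].
  left; apply: (mirror M) => //.
  have [z1 [vE _]] := levi_ler LE Mv.
  have [z2 [vbE _]] := levi_le (esym RE) Mv.
  have e : z1 * M = wbar z2 * wbar M by rewrite -vE -[v]wbarK vbE wbarM.
  have [] // := eq_wmul e.
  by have := eq_wlen e; rewrite !wlenM wlen_bar => /GRing.addIr.
have [z1 [ME _]] := levi_ler (esym LE) vM.
have [z2 [ME2 _]] := levi_le RE vM.
have e : z1 * v = wbar v * z2 by rewrite -ME -ME2.
case: (Order.TotalTheory.leP (wlen z1) (wlen v)) => [z1v|/Order.POrderTheory.ltW vz1].
  have [o [vbE vE]] := levi_le e z1v.
  have e2 : o * z2 = wbar o * wbar z1 by rewrite -vE -[v]wbarK vbE wbarM.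
  have [oE _] := eq_wmul e2 erefl.
  left; apply: (mirror (z1 * o * wbar z1)).
    by rewrite ME -[v]wbarK vbE wbarM -oE mulgA.
  by rewrite !wbarM wbarK -oE mulgA.
have [K [z1E _]] := levi_le (esym e) vz1.
(* The blocks do not quite meet: the middle of [X] is the finite word [K]. *)
have {}XE : X = y * wbar v * K * (v * x) by rewrite XE ME z1E !mulgA.
have [k KE] : finite_word K.
  apply/finite_wordP; apply: (@ogroup_le_nat _ _ _ (size s + size t)).
    exact: wlen_ge0.
  rewrite GRing.mulrnDr -!wlen_finw -(ogroup_leD2l (wlen y + wlen v + wlen v + wlen x)).
  move: leX; rewrite XE !wlenM wlen_bar !GRing.addrA.
  rewrite [X in X <= _](ACl ((1*2*4*5)*3)) [X in _ <= X](ACl ((4*2*5*3)*1*6)).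
  by [].
have rc : rstar (y * wbar v).
  by move: rX; rewrite XE => /rstar_wmul[/rstar_wmul[]].
right; exists (y * wbar v), k; split=> //.
have e1 : mclass (v * x * (y * wbar v)) = 1.
  apply/evaluates_1; have e1 := evaluates_nest rv (ladder_evaluates lxy).
  by apply: (evaluates_eqw e1); rewrite // !mulgA.
have e2 : mclass (v * x) = mclass (wbar (y * wbar v)).
  have := congr1 (fun m => m * mclass (wbar (y * wbar v))) e1.
  by rewrite (mclassM (v * x)) -mulgA (mclass_barr rc) mulg1 mul1g.
by rewrite XE KE mclassM e2 -mclassM.
Qed.

Lemma infinite_split v n : ~ finite_word v ->
  exists v' s, v = v' * finw s /\ size s = n.
Proof.
elim: n v => [|n IHn] v fv; first by exists v, [::]; rewrite finw_nil mulg1.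
case: (word_last v) => [v1|[v1 [a vE]]].
  by case: fv; rewrite v1; exact: finite1.
have [|v' [s [v1E sn]]] := IHn v1.
  move=> f1; apply: fv; rewrite vE; apply: finite_wmulI => //.
  by exists [:: a]; rewrite finw_seq1.
exists v', (s ++ [:: a]); rewrite finw_cat finw_seq1 vE v1E mulgA size_cat sn.
by rewrite addn1.
Qed.

(** A shifted overlap of an infinite word with itself is periodic at its end,
    and the period of a reduced word has infinite order. *)
Lemma reduced_period v s p q n : reduced v -> ~ finite_word v ->
  p * v = q * v * finw s -> (0 < n)%N -> feval s ^+ n = 1 -> s = [::].
Proof.
move=> rv fv e n0 sn.
have [r vE] : exists r, v = r * finw (iter n (cat^~ s) [::]).
  elim: n v fv e {rv n0 sn} => [|n IHn] v fv e.
    by exists v; rewrite finw_nil mulg1.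
  case/levi: e => [[r [qvE vE]]|[r [_ sE]]]; last first.
    by case: fv; case/finw_eq_wmul: sE => _ [s2 [_ _ ->]]; exists s2.
  have fr : ~ finite_word r.
    by move=> fr; apply: fv; rewrite vE; apply: finite_wmulI => //; exists s.
  have [|r' rE] := IHn r fr; first by rewrite -qvE {1}vE mulgA.
  by exists r'; rewrite {1}vE {1}rE /= finw_cat mulgA.
have ss : iter n (cat^~ s) [::] = [::].
  apply: (@reduced_finw d Om G Sg); first by move: rv; rewrite vE; exact: reducedR.
  have -> : feval (iter n (cat^~ s) [::]) = feval s ^+ n.
    elim: (n) => [|m IHm]; first by rewrite feval_nil.
    by rewrite /= feval_cat IHm expgSr.
  exact: sn.
by case: n n0 ss {sn vE} => //= n _; case: (s) => // a s'; case: (iter n _ _).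
Qed.

Lemma ladder_infinite x y g : ladder x y g -> ~ finite_word x ->
  exists x1 v a b y2, [/\ [/\ x = x1 * v * finw a, y = finw b * wbar v * y2 &
    reduced v], ~ finite_word v & feval a * feval b = 1].
Proof.
elim=> [s t|s v {}x {}y t rv lxy IHl] fx; first by case: fx; exists s.
case: (pselect (finite_word x)) => [[a xE]|/IHl].
  have [b yE] : finite_word y.
    apply: near_finite; apply: near_trans (near_sym (ladder_near lxy)) _.
    by rewrite xE; exact: near_finw.
  exists (finw s), v, a, b, (finw t); split; first by rewrite xE yE.
    move=> fv; apply: fx; do !apply: finite_wmulI => //; first by exists s.
    by exists a.
  have := ladder_evaluates lxy; rewrite xE yE -finw_cat => /evaluates_finw.
  by rewrite feval_cat.
move=> [x1 [v' [a [b [y2 [[-> -> rv'] fv' ab]]]]]].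
exists (finw s * v * x1), v', a, b, (y2 * wbar v * finw t).
by split=> //; split; rewrite ?mulgA.
Qed.

(** If [r * c] equals an element of [G] times [r], then [c] shifts the last
    infinite block of the cancellation of [r] against [c * wbar r] by finitely
    many letters, so [c] is conjugate to a period of that block or to its
    inverse. *)
Lemma tight_centralizer r c n : tight r -> ~ finite_word r ->
  has_value (r * finw c * wbar r) -> (0 < n)%N -> feval c ^+ n = 1 -> feval c = 1.
Proof.
move=> tr fr [g e] n0 cn; rewrite -mulgA in e.
have lad := evaluates_ladder e tr (tight_finl Sg1 c (tight_bar tr)).
have [x1 [v [a [b [y2 [[rE crE rv] fv ab]]]]]] := ladder_infinite lad fr.
(* Shorten the block so that its partner lies entirely after [c]. *)
have [v0 [c1 [vE sc1]]] := infinite_split (size c) fv.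
have fv0 : ~ finite_word v0.
  by move=> f0; apply: fv; rewrite vE; apply: finite_wmulI => //; exists c1.
have rv0 : reduced v0 by move: rv; rewrite vE; exact: reducedL.
have [b' [bE rbE]] : exists b', b ++ fbar c1 = c ++ b' /\
    wbar r = finw b' * (wbar v0 * y2).
  have crE' : finw c * wbar r = finw (b ++ fbar c1) * (wbar v0 * y2).
    by rewrite crE vE wbarM wbar_finw finw_cat !mulgA.
  case/levi: crE' => [[z [bz rbz]]|[z [cz vz]]].
    case/finw_eq_wmul: bz => [s1 [s2 [bE /finw_inj cE zE]]].
    by exists s2; rewrite bE -cE rbz zE.
  case/finw_eq_wmul: cz => [s1 [s2 [cE /finw_inj s1E zE]]].
  have sz := congr1 size cE; rewrite size_cat -s1E size_cat size_rev size_map sc1 in sz.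
  have s20 : s2 = [::].
    by apply/nilP; rewrite /nilp; move/eqP: sz; rewrite eqn_leq => /andP[_]; lia.
  exists [::]; rewrite cats0 finw_nil mul1g vz zE s20 finw_nil mul1g s1E cE s20 cats0.
  by [].
have rE2 : r = wbar y2 * v0 * finw (fbar b').
  by rewrite -[r]wbarK rbE !wbarM wbarK wbar_finw.
have rE1 : r = x1 * v0 * finw (c1 ++ a) by rewrite rE vE finw_cat !mulgA.
have acb : feval (c1 ++ a) * feval c * feval b' = 1.
  have := congr1 (fun l => feval l) bE; rewrite !feval_cat feval_bar => /(congr1 (fun g => feval c1 * feval a * g)).
  by rewrite !mulgA -(mulgA (feval c1)) ab mulg1 mulgV => <-.
have := rE1; rewrite rE2 => /levi[[z [vz bz]]|[z [vz az]]].
  case/finw_eq_wmul: bz => [s1 [s2 [b'E zE /finw_inj s2E]]].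
  have s1c : feval c ^ (feval (c1 ++ a))^-1 = feval s1.
    apply: (mulIg (feval (c1 ++ a))); rewrite conjgE invgK mulgA mulgVK.
    by rewrite [in RHS]s2E -feval_cat -b'E feval_bar; apply: (mulIg (feval b')); rewrite acb mulVg.
  have s10 : s1 = [::].
    apply: (reduced_period rv0 fv0 _ n0); first by rewrite -zE; exact: vz.
    by rewrite -s1c -conjXg cn conj1g.
  by move: s1c; rewrite s10 feval_nil => /eqP; rewrite conjg_eq1 => /eqP.
case/finw_eq_wmul: az => [s1 [s2 [aE zE /finw_inj s2E]]].
have s1c : feval c ^ (feval b') = (feval s1)^-1.
  apply: (mulgI (feval s1)); rewrite mulgV conjgE -acb aE feval_cat -s2E feval_bar.
  by rewrite !mulgA.
have s10 : s1 = [::].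
  apply: (reduced_period rv0 fv0 _ n0); first by rewrite -zE; exact: vz.
  by rewrite -[feval s1]invgK -s1c expVgn -conjXg cn conj1g invg1.
by move: s1c; rewrite s10 feval_nil invg1 => /eqP; rewrite conjg_eq1 => /eqP.
Qed.

End Centres.

(** * Torsion words *)

Section Torsion.
Set Implicit Arguments.
Unset Strict Implicit.
Local Open Scope group_scope.
Context {d : Order.disp_t} {Om : bOrderType d} {G : groupType} {Sg : set G}.
Context (Sg1 : forall a : G, Sg a -> a <> 1).
Context (S0 : seq (letter Sg) -> seq (letter Sg) -> Prop) (aS0 : admissible S0).
Local Notation "x =>* y" := (sstar S0 x y) (at level 70, no associativity).
Local Notation word := (word Om Sg).
Local Notation finw := (@finw _ Om _ Sg).
Implicit Types (x y z p q u v w : word) (s t f k : seq (letter Sg)) (g h : G)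
  (L M : seq word).

Definition torsion_word x : Prop := exists2 n, (0 < n)%N & mclass x ^+ n = 1.

Lemma mclass_finwX s n : mclass (finw s) ^+ n = 1 -> feval s ^+ n = 1.
Proof.
have -> : mclass (finw s) ^+ n = mclass (finw (iter n (cat s) [::])).
  elim: n => [|n IHn]; first by rewrite finw_nil.
  by rewrite expgS IHn -mclassM -finw_cat.
move/finw_1; have -> // : feval (iter n (cat s) [::]) = feval s ^+ n.
elim: n => [|n IHn]; first by rewrite feval_nil.
by rewrite /= feval_cat IHn expgS.
Qed.

Lemma expg_conj (T : monoidType) (a b m : T) n :
  a * b = 1 -> b * a = 1 -> (b * m * a) ^+ n = b * m ^+ n * a.
Proof.
move=> ab ba; elim: n => [|n IHn]; first by rewrite mulg1 ba.
by rewrite !expgS IHn -!mulgA (mulgA a) ab mul1g.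
Qed.

Lemma torsion_conj x y z : rstar z -> mclass x = mclass (z * y * wbar z) ->
  torsion_word x -> torsion_word y.
Proof.
move=> rz xE [n n0 xn]; exists n => //.
have -> : mclass y = mclass (wbar z) * mclass x * mclass z.
  rewrite xE !mclassM !mulgA mclass_barl // mul1g -mulgA mclass_barl // mulg1 //.
rewrite expg_conj ?mclass_barl ?mclass_barr // xn mulg1; exact: mclass_barl.
Qed.

Lemma finite_conjugate_conj x y z : rstar z ->
  mclass x = mclass (z * y * wbar z) -> finite_conjugate y -> finite_conjugate x.
Proof.
move=> rz xE [c [s [rc yE]]]; exists (z * c), s; split; first exact: rstarM.
by rewrite xE wbarM !mclassM yE !mclassM !mulgA.
Qed.

(** With [w = p * q], the conjugate [X = q * p] has its square in [G]: [q]
    cancels against the beginning [q'] of [w], and what remains of [w] after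
    [q'] cancels against [p], as it ends [w] and is as long as [p]. So [X]
    commutes with its torsion square; and one of [p] and [q'] begins with the
    other, which leaves [X] as an element of [G] times a tight word [r]. *)
Lemma absorbed_square w : tight w -> ~ finite_conjugate w -> torsion_word w ->
  absorbed w w w -> mclass (w * w) = 1.
Proof.
move=> tw fw [n n0 wn] [o [p' [p [q [q' [o' [[wo wpq wq] [g1 e1] [g2 e2]]]]]]]].
have [tp tq] : tight p /\ tight q by move: tw; rewrite wpq => /tight_wmul.
have [_ tp'] : tight o /\ tight p' by move: tw; rewrite wo => /tight_wmul.
have [tq' to'] : tight q' /\ tight o' by move: tw; rewrite wq => /tight_wmul.
have np : near (wlen p') (wlen p) := ladder_near (evaluates_ladder e1 tp' tp).
have nq : near (wlen q) (wlen q') := ladder_near (evaluates_ladder e2 tq tq').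
have no : near (wlen p') (wlen o').
  apply: near_trans np _; apply: (@near_cancel _ _ (wlen q) _ (wlen q')) nq.
  by rewrite GRing.addrC -!wlenM -wpq -wq; exact: near_refl.
have [g3 e3] : has_value (o' * p).
  have : o * p' = q' * o' by rewrite -wo -wq.
  case/levi=> [[z [_ p'E]]|[z [_ o'E]]].
    have [s zE] : finite_word z by apply: (@near_finite_eq1 _ _ _ _ _ o'); rewrite -p'E.
    move: e1; rewrite p'E zE -mulgA => /evaluates_divl e1.
    by eexists; exact: e1.
  have [s zE] : finite_word z.
    by apply: (@near_finite_eq1 _ _ _ _ _ p'); rewrite -o'E; exact: near_sym no.
  rewrite o'E zE -mulgA; eexists; apply: evaluates_mul e1; exact: evaluates_fin.
have [s2 _ qq'] := evaluatesE e2; have [s3 _ o'p] := evaluatesE e3.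
have [rp rq] : rstar p /\ rstar q by split; [case: tp|case: tq].
pose c := s2 ++ s3.
have [X XqpE] : exists X, X = mclass q * mclass p by eexists.
have W1 : mclass w = mclass p * mclass q by rewrite wpq mclassM.
have W2 : mclass w = mclass q' * mclass o' by rewrite wq mclassM.
have WX : mclass w = mclass p * X * mclass (wbar p).
  by rewrite XqpE W1 -!mulgA mclass_barr // mulg1.
have XX : X * X = mclass (finw c).
  rewrite XqpE finw_cat mclassM -qq' -o'p !mclassM -!mulgA; congr (_ * _).
  by rewrite !mulgA -W1 W2.
have Xn : X ^+ n = 1.
  have -> : X = mclass (wbar p) * mclass w * mclass p.
    by rewrite WX -!mulgA mclass_barl // mulg1 !mulgA mclass_barl // mul1g.
  by rewrite expg_conj ?mclass_barl ?mclass_barr // wn mulg1; exact: mclass_barl.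
have cn : feval c ^+ n = 1.
  by apply: mclass_finwX; rewrite -XX expgMn // Xn mulg1.
have XC : mclass (finw c) * X = X * mclass (finw c) by rewrite -XX mulgA.
have [r [tr XE]] : exists r, tight r /\ X = mclass (finw s2) * mclass r.
  have : q' * o' = p * q by rewrite -wpq -wq.
  case/levi=> [[r [pE _]]|[r [q'E _]]].
    exists r; split; first by move: tp; rewrite pE => /tight_wmul[].
    by rewrite XqpE pE mclassM mulgA -(mclassM q) qq'.
  have tr : tight r by move: tq'; rewrite q'E => /tight_wmul[].
  exists (wbar r); split; first exact: tight_bar.
  rewrite -qq' q'E !mclassM XqpE -!mulgA mclass_barr ?mulg1 //; by case: tr.
have rr : rstar r by case: tr.
have fr : ~ finite_word r.
  case=> t rE; apply: fw; exists p, (s2 ++ t); split=> //.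
  by rewrite WX XE rE finw_cat !mclassM.
have c1 : feval c = 1.
  apply: (tight_centralizer Sg1 tr fr _ n0 cn).
  exists (feval (fbar s2 ++ c ++ s2)); apply/evaluatesP.
  have e0 : mclass (finw (fbar s2)) * mclass (finw s2) = 1.
    rewrite -mclassM -finw_cat; transitivity (mclass (finw [::])); last by rewrite finw_nil.
    by apply: mclass_finw; rewrite feval_cat feval_bar mulVg feval_nil.
  have h : mclass r * mclass (finw c) = mclass (finw (fbar s2)) * mclass (finw c) * mclass (finw s2) * mclass r.
    have := congr1 (fun m => mclass (finw (fbar s2)) * m) XC.
    by rewrite XE !mulgA e0 mul1g.
  rewrite mclassM (mclassM r) h -!mulgA mclass_barr // mulg1.
  by rewrite !finw_cat !mclassM.
have XX1 : X * X = 1.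
  rewrite XX; transitivity (mclass (finw [::])); last by rewrite finw_nil.
  by apply: mclass_finw; rewrite c1 feval_nil.
rewrite mclassM WX -!mulgA (mulgA (mclass (wbar p))) mclass_barl // mul1g.
by rewrite (mulgA X) XX1 mul1g mclass_barr.
Qed.

Lemma tight_self_inverse w : tight w -> ~ finite_conjugate w -> torsion_word w ->
  absorbed w w w -> self_inverse_reduct S0 w.
Proof.
move=> tw fw hw aw; have /evaluates_1 e := absorbed_square tw fw hw aw.
have lad := evaluates_ladder e tw tw.
have rw : rstar w by case: tw.
have le2 : (wlen w <= wlen w + wlen w)%R.
  by rewrite -{1}[wlen w]GRing.addr0 ogroup_leD2l; exact: wlen_ge0.
by have [] := ladder_centre Sg1 aS0 rw lad (esym (mul1g w)) (esym (mulg1 w)) le2.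
Qed.

Definition all_tight L : Prop := forall x, x \in L -> tight x.

Lemma all_tight_cons x L : all_tight (x :: L) <-> tight x /\ all_tight L.
Proof.
split=> [h|[tx tL] y]; last by rewrite inE => /orP[/eqP->|/tL].
by split=> [|y yL]; apply: h; rewrite inE ?eqxx ?yL ?orbT.
Qed.

Lemma all_tight_cat L M : all_tight (L ++ M) <-> all_tight L /\ all_tight M.
Proof.
split=> [h|[tL tM] y]; last by rewrite mem_cat => /orP[/tL|/tM].
by split=> y yL; apply: h; rewrite mem_cat yL ?orbT.
Qed.

Lemma all_tight1 x : tight x -> all_tight [:: x].
Proof. by move=> tx y; rewrite inE => /eqP->. Qed.

Lemma rstar_all_tight w : rstar w -> exists2 L, all_tight L & w = prodw L.
Proof.
elim=> [|u ru|x y _ [L tL ->] _ [M tM ->]].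
- by exists [::]; rewrite ?prodw_nil.
- exists [:: u]; last by rewrite prodw_cons prodw_nil mulg1.
  by apply: all_tight1; exact: tight_reduced.
- by exists (L ++ M); rewrite ?prodw_cat //; apply/all_tight_cat.
Qed.

Definition bar_list L := rev (map (@wbar _ _ _ _) L).

Lemma prodw_bar L : prodw (bar_list L) = wbar (prodw L).
Proof.
elim: L => [|x L IHL]; first by rewrite /bar_list /= !prodw_nil wbar1.
by rewrite /bar_list /= rev_cons prodw_rcons -/(bar_list L) IHL prodw_cons wbarM.
Qed.

Lemma all_tight_bar L : all_tight L -> all_tight (bar_list L).
Proof.
by move=> h x; rewrite mem_rev => /mapP[y yL ->]; apply: tight_bar; exact: h.
Qed.

Lemma absorbed_bar x y z : absorbed x y z -> absorbed (wbar z) (wbar y) (wbar x).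
Proof.
case=> o [p' [p [q [q' [o' [[-> -> ->] [g e] [h f]]]]]]].
exists (wbar o'), (wbar q'), (wbar q), (wbar p), (wbar p'), (wbar o).
rewrite !wbarM; split=> //.
  by exists h^-1; rewrite -wbarM; exact: evaluates_bar.
by exists g^-1; rewrite -wbarM; exact: evaluates_bar.
Qed.

(** A reduction, rather than an equality of classes, so that a self-inverse
    reduct of the middle part is inherited. *)
Definition shortens L : Prop := exists z L', [/\ rstar z, all_tight L',
  (size L' < size L)%N & prodw L =>* z * prodw L' * wbar z].

Lemma shortens_bar L : shortens (bar_list L) -> shortens L.
Proof.
case=> z [L' [rz tL' sL' h]]; exists z, (bar_list L'); split=> //.
- exact: all_tight_bar.
- by move: sL'; rewrite !size_rev !size_map.
- have := sstar_bar aS0 h; rewrite prodw_bar wbarK !wbarM wbarK -prodw_bar mulgA.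
  exact.
Qed.

Lemma has_value_sstar x : has_value x -> exists s, x =>* finw s.
Proof. by case=> g /(evaluates_sstar aS0)[s []]; exists s. Qed.

Lemma shortens_middle L x y z M : all_tight (L ++ [:: x, y, z & M]) ->
  absorbed x y z -> shortens (L ++ [:: x, y, z & M]).
Proof.
move=> /all_tight_cat[tL /all_tight_cons[tx /all_tight_cons[_ /all_tight_cons[tz tM]]]].
case=> o [p' [p [q [q' [o' [[xE yE zE] /has_value_sstar[s hs] /has_value_sstar[t ht]]]]]]].
exists 1, (L ++ [:: o * finw s, finw t * o' & M]); split.
- exact: rstar1.
- apply/all_tight_cat; split=> //; apply/all_tight_cons; split; last first.
    apply/all_tight_cons; split=> //; apply: tight_finl => //.
    by move: tz; rewrite zE => /tight_wmul[].
  by apply: tight_finr => //; move: tx; rewrite xE => /tight_wmul[].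
- by rewrite !size_cat /=; lia.
- rewrite wbar1 mulg1 mul1g !prodw_cat !prodw_cons xE yE zE.
  have -> : prodw L * (o * p' * (p * q * (q' * o' * prodw M))) =
      prodw L * o * (p' * p) * (q * q') * (o' * prodw M) by rewrite !mulgA.
  have -> : prodw L * (o * finw s * (finw t * o' * prodw M)) =
      prodw L * o * finw s * finw t * (o' * prodw M) by rewrite !mulgA.
  by do 3?[apply: sstarM => //]; exact: sstar_refl.
Qed.

(** The first side is absorbed by the last and the second: the cancellation
    against the last one conjugates the rest of the product. With two sides
    only, both ends of the second one are consumed, and they may overlap. *)
Lemma shortens_first y z L : all_tight [:: y, z & L] ->
  absorbed (last z L) y z -> shortens [:: y, z & L].
Proof.
move=> tL; move: (tL) => /all_tight_cons[ty /all_tight_cons[tz tL']].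
case=> o [p' [p [q [q' [o' [[xE yE zE] [g e] /has_value_sstar[k hk]]]]]]].
have [tp tq] : tight p /\ tight q by move: ty; rewrite yE => /tight_wmul.
have to' : tight o' by move: tz; rewrite zE => /tight_wmul[].
case/lastP: L xE tL tL' => [|L u] xE tL tL'.
  rewrite /= in xE; have : o * p' = q' * o' by rewrite -xE -zE.
  have tp' : tight p' by move: tz; rewrite xE => /tight_wmul[].
  case/levi=> [[r [q'E p'E]]|[r [oE o'E]]].
    have [y1 [y2 [pE [h f]]]] := ladder_cut (evaluates_ladder e tp' tp) p'E.
    have [ty1 ty2] : tight y1 /\ tight y2 by move: tp; rewrite pE => /tight_wmul.
    have [c [s [t [rc yc oc]]]] := ladder_arms Sg1 aS0 (evaluates_ladder f to' ty1).
    exists c, [:: finw t * y2 * finw (k ++ s)]; split=> //.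
      by apply: all_tight1; apply: tight_finr => //; exact: tight_finl.
    rewrite !prodw_cons prodw_nil !mulg1 yE pE zE.
    have -> : y1 * y2 * q * (q' * o') = y1 * y2 * (q * q') * o' by rewrite !mulgA.
    have -> : c * (finw t * y2 * finw (k ++ s)) * wbar c =
       c * finw t * y2 * finw k * (finw s * wbar c) by rewrite finw_cat !mulgA.
    by do 3?[apply: sstarM => //]; exact: sstar_refl.
  have tr : tight r by move: to'; rewrite o'E => /tight_wmul[].
  have [c [s [t [rc pc p'c]]]] := ladder_arms Sg1 aS0 (evaluates_ladder e tp' tp).
  exists c, [:: finw (t ++ k) * r * finw s]; split=> //.
    by apply: all_tight1; apply: tight_finr => //; exact: tight_finl.
  rewrite !prodw_cons prodw_nil !mulg1 yE zE o'E.
  have -> : p * q * (q' * (r * p')) = p * (q * q') * r * p' by rewrite !mulgA.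
  have -> : c * (finw (t ++ k) * r * finw s) * wbar c =
       c * finw t * finw k * r * (finw s * wbar c) by rewrite finw_cat !mulgA.
  by do 3?[apply: sstarM => //]; exact: sstar_refl.
rewrite last_rcons in xE.
move: tL'; rewrite -cats1 => /all_tight_cat[tL' /all_tight_cons[tu _]].
have [to tp'] : tight o /\ tight p' by move: tu; rewrite xE => /tight_wmul.
have [c [s [t [rc pc p'c]]]] := ladder_arms Sg1 aS0 (evaluates_ladder e tp' tp).
exists c, (finw (t ++ k) * o' :: L ++ [:: o * finw s]); split=> //.
- apply/all_tight_cons; split; first exact: tight_finl.
  by apply/all_tight_cat; split=> //; apply: all_tight1; exact: tight_finr.
- by rewrite /= !size_cat /=; lia.
- rewrite !prodw_cons !prodw_cat !prodw_cons prodw_nil !mulg1 yE zE xE.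
  have -> : p * q * (q' * o' * (prodw L * (o * p'))) =
    p * (q * q') * (o' * prodw L * o) * p' by rewrite !mulgA.
  have -> : c * (finw (t ++ k) * o' * (prodw L * (o * finw s))) * wbar c =
    c * finw t * finw k * (o' * prodw L * o) * (finw s * wbar c).
    by rewrite finw_cat !mulgA.
  by do 3?[apply: sstarM => //]; exact: sstar_refl.
Qed.

Lemma nth_power L n i : (i < n * size L)%N ->
  nth 1 (flatten (nseq n L)) i = nth 1 L (i %% size L).
Proof.
elim: n i => [|n IHn] i //= iN; rewrite nth_cat; case: (ltnP i (size L)) => iL.
  by rewrite modn_small.
rewrite IHn; last by move: iN; rewrite mulSn; lia.
by rewrite -[X in _ = nth _ _ (X %% _)%N](subnK iL) modnDr.
Qed.

Lemma ear_power L n : all_tight L -> (1 < size L)%N ->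
  ear (flatten (nseq n L)) -> shortens L.
Proof.
move=> tL L1 [M1 [x [y [z [M2 [E ab]]]]]].
have sE : size (flatten (nseq n L)) = (n * size L)%N.
  by rewrite size_flatten /shape map_nseq sumn_nseq mulnC.
have iN : (size M1 + 3 <= n * size L)%N.
  by rewrite -sE E size_cat /= leq_add2l.
have nthE j : (j < 3)%N -> nth 1 [:: x; y; z] j = nth 1 L ((size M1 %% size L + j) %% size L).
  move=> j3; rewrite modnDml -(@nth_power L n); last lia.
  by rewrite E nth_cat ltnNge leq_addr /= addKn; case: j j3 => [|[|[|j]]].
move: (nthE 0%N isT) (nthE 1%N isT) (nthE 2 isT) => /=.
have L0 : (0 < size L)%N by lia.
move: (ltn_pmod (size M1) L0); move: (size M1 %% size L)%N => r rL.
case: (ltnP r.+2 (size L)) => [r2|].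
  rewrite !modn_small ?addn0 ?addn1 ?addn2 //; try lia.
  move=> xE yE zE.
  have LE : L = take r L ++ [:: x, y, z & drop r.+3 L].
    rewrite -{1}(cat_take_drop r L) (drop_nth 1) // -xE.
    by rewrite (drop_nth 1) 1?ltnW // -yE (drop_nth 1) // -zE.
  rewrite LE; apply: shortens_middle => //; by rewrite -LE.
case: (ltnP r.+1 (size L)) => [r1 r2|r1 _].
  have mE : size L = r.+2 by apply/eqP; rewrite eqn_leq r2.
  rewrite !mE addn0 addn1 addn2 modnn !modn_small // => xE yE zE.
  apply: shortens_bar.
  have LE : L = take r L ++ [:: x; y].
    rewrite -{1}(cat_take_drop r L) (drop_nth 1) // -xE (drop_nth 1) // -yE.
    by rewrite drop_oversize // mE.
  have bE : bar_list L = [:: wbar y, wbar x & bar_list (take r L)].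
    by rewrite {1}LE /bar_list map_cat rev_cat.
  rewrite bE; apply: shortens_first.
    by rewrite -bE; exact: all_tight_bar.
  suff -> : last (wbar x) (bar_list (take r L)) = wbar z by exact: absorbed_bar.
  move: zE; rewrite {1}LE; case: (take r L) => [|a l] /= ->; first by [].
  by rewrite /bar_list /= rev_cons last_rcons.
have mE : size L = r.+1 by apply/eqP; rewrite eqn_leq r1.
rewrite !mE addn0 addn1 addn2 modnn (modn_small (ltnSn r)) -addn1 modnDl modn_small; last lia.
move=> xE yE zE.
have LE : L = [:: y, z & drop 2 L].
  by rewrite -[L in LHS]drop0 (drop_nth 1) // -yE (drop_nth 1) // -zE.
rewrite LE; apply: shortens_first; first by rewrite -LE.
suff -> : last z (drop 2 L) = x by [].
rewrite xE -[r]/(r.+1.-1) -mE nth_last LE /=.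
by rewrite drop0.
Qed.

Lemma mclass_power L n :
  mclass (prodw (flatten (nseq n L))) = mclass (prodw L) ^+ n.
Proof.
elim: n => [|n IHn]; first by rewrite /= prodw_nil.
by rewrite /= prodw_cat mclassM IHn expgS.
Qed.

Lemma torsion_self_inverse m L : (size L <= m)%N -> all_tight L ->
  torsion_word (prodw L) -> ~ finite_conjugate (prodw L) ->
  self_inverse_reduct S0 (prodw L).
Proof.
elim: m L => [|m IHm] L sL tL tw fw.
  case: fw; exists 1, [::]; split; first exact: rstar1.
  by case: (L) sL => // _; rewrite prodw_nil finw_nil wbar1 !mulg1.
case: (posnP (size L)) => [/size0nil L0|L0]; first by apply: IHm; rewrite // L0.
have [n n0 wn] := tw.
(* The factor 3 provides an inner side even if [n] and [size L] are 1. *)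
have eL : ear (flatten (nseq (n * 3) L)).
  apply: (@evaluates_ear _ _ _ _ _ 1).
    by apply/evaluates_1; rewrite mclass_power expgnA wn expg1n.
  rewrite size_flatten /shape map_nseq sumn_nseq mulnC.
  by rewrite -mulnA; move: n0 L0; case: (n) => // n' _; case: (size L) => // l _; lia.
have [L1|L1] := ltnP 1 (size L).
  have [z [L' [rz tL' sL' h]]] := ear_power tL L1 eL.
  have zE := sstar_mclass aS0 h.
  apply: (self_inverse_conj h); apply: IHm => //.
  - by rewrite -ltnS (leq_trans sL').
  - exact: torsion_conj rz zE tw.
  - by move/(finite_conjugate_conj rz zE).
case: L tL tw fw L0 L1 eL {sL wn} => [|w [|? ?]] // tL tw fw _ _ eL.
rewrite prodw_cons prodw_nil mulg1 in tw fw *.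
have tw' : tight w by apply: tL; rewrite inE.
apply: tight_self_inverse => //.
case: eL => M1 [x [y [z [M2 [E ab]]]]].
have all_w a : a \in M1 ++ [:: x, y, z & M2] -> a = w.
  rewrite -E => /flattenP[l]; rewrite mem_nseq => /andP[_ /eqP->].
  by rewrite inE => /eqP.
have [xw yw zw] : [/\ x = w, y = w & z = w].
  by split; apply: all_w; rewrite mem_cat !inE eqxx !orbT.
by rewrite xw yw zw in ab.
Qed.

Lemma sstar_rstar x y : x =>* y -> rstar x -> rstar y.
Proof.
elim=> [{}x {}y [p [q [l [r [lr -> ->]]]]]|//|{}x {}y z _ h1 _ h2 rx]; last exact: h2 (h1 rx).
move=> /rstar_wmul[/rstar_wmul[rp _] rq].
apply: rstarM => //; apply: rstarM => //.
case: lr => [[l' [r' [_ _ ->]]]|[u [_ _ _ ->]]]; [exact: rstar_finw|exact: rstar1].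
Qed.

End Torsion.

Theorem proposition6p2
  (d : Order.disp_t) (Om : bOrderType d)
  (Om_wf : well_founded (fun i j : Om => (i < j)%O))
  (Om_rank : exists i j : Om, i != j)
  (G : groupType) (G_infinite : infinite_set [set: G])
  (Sg : set G) (Sg_neq1 : forall a : G, Sg a -> a <> 1%g)
  (Sg_gen : generates Sg)
  (S0 : seq (letter Sg) -> seq (letter Sg) -> Prop)
  (S0_admissible : admissible S0)
  (x : egroup Om Sg)
  (x_torsion : torsion x)
  (x_nconj : forall (c : egroup Om Sg) (g : G),
     (x ^ c)%g <> emb Om Sg_neq1 Sg_gen g)
  (w : word Om Sg) (w_rstar : rstar w) (w_repr : mclass w = val x) :
  (exists2 y : word Om Sg, sstar S0 w y & y = wbar y) /\ (x ^+ 2 = 1)%g.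
Proof.
have valX n : (val (x ^+ n) = mclass w ^+ n)%g.
  elim: n => [|n IHn]; first by [].
  by rewrite !expgS val_egroupM IHn w_repr.
have tw : torsion_word w.
  case: x_torsion => n n0 xn; exists n => //.
  by rewrite -valX xn.
have fw : ~ finite_conjugate w.
  case=> c [s [rc wE]]; apply: (x_nconj (ein rc) (feval s)).
  rewrite conjgE; apply: (mulgI (ein rc)); rewrite mulVKg.
  apply: val_inj; rewrite !val_egroupM emb_feval /= -w_repr wE !mclassM.
  by rewrite -mulgA mclass_barl // mulg1.
have [L tL wL] := rstar_all_tight w_rstar.
have [y wy yE] : self_inverse_reduct S0 w.
  rewrite wL in tw fw *.
  exact: (torsion_self_inverse Sg_neq1 S0_admissible (leqnn (size L))).
split; first by exists y.
have ry := sstar_rstar Sg_neq1 wy w_rstar.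
apply: val_inj; rewrite valX expgS expg1 (sstar_mclass S0_admissible wy).
by rewrite {2}yE mclass_barr.
Qed.
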